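(* Let $J\subseteq R$ be a quasi-stable ideal of depth $\geq2$. Then, for every parameter $c$ in the set $C$, there exists a polynomial $q_c\in\mathbb K[B]$ such that $c=q_c$ in the ring $\mathbb K[B,C]/\mathscr S$, and the projection onto the second factor $\pi_2:\underline{\mathbf{Mf}}^{\mathrm{syz}}_J\to\underline{\mathbf{Mf}}^{\pi_2}_J$, given by $(M,S_1)\mapsto S_1$, is an isomorphism of functors. In particular, $\mathbb K[B,C]/\mathscr S$ and $\mathbb K[B]/(\mathscr S\cap\mathbb K[B])$ are isomorphic.
   Context: $\mathbb K$ is a field, $R=\mathbb K[x_0,\dots,x_n]$ with the standard grading and $x_0<\dots<x_n$; for a $\mathbb K$-algebra $A$, $R_A=R\otimes_{\mathbb K}A$. The depth of an ideal is the maximal length of a regular sequence of the ring consisting of elements of the ideal. A term of $R$ is a monomial $x^\alpha$; for $x^\alpha\neq1$, $\min(x^\alpha)$, $\max(x^\alpha)$ are the smallest and largest variable dividing it. Variables $x_i>\min(x^\alpha)$ are non-multiplicative for $x^\alpha$ (the term $1$ has none). For a monomial ideal $J$ (or monomial submodule of a free module), $\mathcal N(J)$ is the set of terms not in it. All ideals and submodules are graded. Pommaret cone: $\mathcal C(x^\alpha)=\{x^\delta x^\alpha\mid\delta_i=0\ \forall x_i>\min(x^\alpha)\}$ for $x^\alpha\neq 1$, $\mathcal C(1)=$ all terms, and $\mathcal C(x^\alpha\mathbf e_k)=\mathcal C(x^\alpha)\mathbf e_k$ in a free module with basis $\mathbf e_k$. A Pommaret basis of a monomial ideal or module is a set of generating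 terms whose cones partition its set of terms; it is unique if it exists, denoted $\mathcal P_J$. $J$ is quasi-stable if it has a finite Pommaret basis, stable if moreover $\mathcal P_J$ is its minimal monomial generating set. A $J$-marked set is a finite set $F=\{f_\alpha\}_{x^\alpha\in\mathcal P_J}\subset R_A$ of homogeneous polynomials such that $x^\alpha$ has coefficient $1$ in $f_\alpha$ and the support of $f_\alpha-x^\alpha$ is in $\mathcal N(J)$; it is a $J$-marked basis of $(F)$ if $R_A=(F)\oplus\langle\mathcal N(J)\rangle_A$. A graded ideal $M\subset R_A$ satisfies $M\oplus\langle\mathcal N(J)\rangle=R_A$ iff it is generated by a (unique) $J$-marked basis. Functors on Noetherian $\mathbb K$-algebras (acting on morphisms by extension of scalars): $\underline{\mathbf{Mf}}^{\mathrm{syz}}_J(A)$ is the set of pairs $(M,S_1)$ with $M\subset R_A$, $M\oplus\langle\mathcal N(J)\rangle=R_A$, and $S_1$ the module of first syzygies of the $J$-marked basis of $M$; $\underline{\mathbf{Mf}}^{\pi_2}_J(A)$ is the set of modules $S_1$ such that $S_1$ is the syzygy module of the $J$-marked basis of some $M\subset R_A$ with $M\oplus\langle\mathcal N(J)\rangle=R_A$. Parameters. $C=\{C_\alpha^\beta\mid x^\alpha\in\mathcal P_J,\ x^\beta\in\mathcal N(J),\ |\beta|=|\alpha|\}$ are indeterminates; $F_\alpha=x^\alpha-\sum_\beta C_\alpha^\beta x^\beta$. Let $\mathbf f_\alpha$ be free basis elements of degree $|\alpha|$ indexed by $\mathcal P_J$, and $J^{(1)}\subset\bigoplus R\,\mathbf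 f_\alpha$ the stable module with Pommaret basis $\{x_i\mathbf f_\alpha\mid x_i>\min(x^\alpha)\}$. For $x_i>\min(x^\alpha)$ let $\mathsf s_{i,\alpha}$ be the set of terms $x^\eta\mathbf f_\gamma\in\mathcal N(J^{(1)})$ with $x^\gamma\in\mathcal P_J$, $\max(x^\eta)\le\min\{x_{i-1},\min(x^\gamma)\}$ ($x^\eta=1$ allowed) and $|\eta|+|\gamma|=|\alpha|+1$. $B$ is the set of indeterminates $B_{i,\alpha}^{\eta,\gamma}$, one for each $(i,\alpha)$ and each $x^\eta\mathbf f_\gamma\in\mathsf s_{i,\alpha}$. $\mathscr S\subseteq\mathbb K[B,C]$ is the ideal generated by the coefficients (with respect to $x_0,\dots,x_n$) of all polynomials $x_iF_\alpha-\sum_{x^\eta\mathbf f_\gamma\in\mathsf s_{i,\alpha}}B_{i,\alpha}^{\eta,\gamma}x^\eta F_\gamma$, for $x^\alpha\in\mathcal P_J$, $x_i>\min(x^\alpha)$. *)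

(* Defs.v *)
From HB Require Import structures.
From mathcomp Require Import all_boot all_order all_algebra.
From mathcomp Require Import generic_quotient ring_quotient.
From mathcomp Require Import finmap.
From mathcomp Require Import boolp.
From mathcomp Require Import ssrcomplements freeg mpoly.

Set Implicit Arguments.
Unset Strict Implicit.
Unset Printing Implicit Defensive.

Import GRing.Theory.

Local Open Scope ring_scope.
Local Open Scope quotient_scope.

Definition rspan (R : nzRingType) (V : lmodType R) (G : V -> Prop) : V -> Prop :=
  fun v => exists k (c : 'I_k -> R) (g : 'I_k -> V),
    (forall i, G (g i)) /\ v = \sum_(i < k) c i *: g i.

Definition ideal_gen (R : comNzRingType) (G : R -> Prop) : R -> Prop :=
  @rspan R R^o G.

Definition is_ideal (R : comNzRingType) (I : R -> Prop) : Prop :=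
  [/\ I 0, forall x y, I x -> I y -> I (x + y) & forall a x, I x -> I (a * x)].

(* Improper ideals are allowed, unlike for the library's [idealr]. *)
Record ideal (R : comNzRingType) := Ideal {
  ideal_mem :> R -> Prop;
  idealP : is_ideal ideal_mem
}.

Lemma ideal_genP (R : comNzRingType) (G : R -> Prop) : is_ideal (ideal_gen G).
Proof.
split.
- by exists 0, (fun=> 0), (fun=> 0); rewrite big_ord0; split=> // -[].
- move=> _ _ [k [c [g [Gg ->]]]] [l [d [h [Gh ->]]]].
  exists (k + l)%N.
  exists (fun i => match split i with inl j => c j | inr j => d j end).
  exists (fun i => match split i with inl j => g j | inr j => h j end).
  split=> [i|]; first by case: (split i).
  rewrite big_split_ord /=; congr (_ + _); apply: eq_bigr => i _.
    by rewrite -[lshift _ _]/(unsplit (inl i)) unsplitK.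
  by rewrite -[rshift _ _]/(unsplit (inr i)) unsplitK.
- move=> a _ [k [c [g [Gg ->]]]]; exists k, (fun i => a * c i), g; split=> //.
  by rewrite mulr_sumr; apply: eq_bigr => i _; apply: mulrA.
Qed.

Definition gen_ideal (R : comNzRingType) (G : R -> Prop) : ideal R :=
  Ideal (ideal_genP G).

Lemma preim_idealP (R S : comNzRingType) (f : {rmorphism R -> S}) (I : ideal S) :
  is_ideal (fun x => I (f x)).
Proof.
have [I0 ID IM] := idealP I; split; first by rewrite rmorph0.
- by move=> x y Ix Iy; rewrite rmorphD; apply: ID.
- by move=> a x Ix; rewrite rmorphM; apply: IM.
Qed.

Definition preim_ideal (R S : comNzRingType) (f : {rmorphism R -> S})
  (I : ideal S) : ideal R := Ideal (preim_idealP f I).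

Section Quotient.
Variables (K : fieldType) (R : comAlgType K) (I : ideal R).

Definition ideal_pred : {pred R} := fun x => `[< I x >].

Lemma ideal_pred_zmod : zmod_closed ideal_pred.
Proof.
have [I0 ID IM] := idealP I; split; first exact/asboolP.
move=> x y /asboolP Ix /asboolP Iy; apply/asboolP; apply: ID => //.
by rewrite -mulN1r; apply: IM.
Qed.

HB.instance Definition _ := GRing.isZmodClosed.Build R ideal_pred
  ideal_pred_zmod.

Lemma ideal_predM a x : x \in ideal_pred -> a * x \in ideal_pred.
Proof.
by have [_ _ IM] := idealP I; move=> /asboolP Ix; apply/asboolP/IM.
Qed.

(* The quotient algebra R / I.  It is a commutative ring, possibly trivial,
   together with a K-module structure. *)
Definition quotalg : Type := Quotient.quot ideal_pred.

HB.instance Definition _ := Choice.on quotalg.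
HB.instance Definition _ := GRing.Zmodule.on quotalg.

Definition qproj (x : R) : quotalg := \pi_(Quotient.quot ideal_pred) x.

Definition qrepr (x : quotalg) : R := repr (x : Quotient.quot ideal_pred).

Lemma qreprK : cancel qrepr qproj.
Proof. by move=> x; apply: reprK. Qed.

Lemma qprojP x y : reflect (qproj x = qproj y) (x - y \in ideal_pred).
Proof. by rewrite (Quotient.idealrBE ideal_pred); apply: eqP. Qed.

Lemma qproj_is_zmod_morphism : zmod_morphism qproj.
Proof. by move=> x y; rewrite /qproj raddfB. Qed.

HB.instance Definition _ := GRing.isZmodMorphism.Build R quotalg qproj
  qproj_is_zmod_morphism.

Lemma qreprP x : qrepr (qproj x) - x \in ideal_pred.
Proof. by apply/qprojP; rewrite qreprK. Qed.

Definition qone : quotalg := qproj 1.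
Definition qmul (x y : quotalg) : quotalg := qproj (qrepr x * qrepr y).
Definition qscale (a : K) (x : quotalg) : quotalg := qproj (a *: qrepr x).

Lemma qprojM x y : qproj (x * y) = qmul (qproj x) (qproj y).
Proof.
apply/esym/qprojP; rewrite -(subrKA (x * qrepr (qproj y))) -mulrBl -mulrBr.
apply: rpredD; last exact: ideal_predM (qreprP y).
by rewrite mulrC; apply: ideal_predM (qreprP x).
Qed.

Lemma qprojZ a x : qproj (a *: x) = qscale a (qproj x).
Proof.
apply/esym/qprojP; rewrite -scalerBr -mulr_algl.
exact: ideal_predM (qreprP _).
Qed.

Fact qmulA : associative qmul.
Proof.
move=> x y z; rewrite -(qreprK x) -(qreprK y) -(qreprK z).
by rewrite -!qprojM mulrA.
Qed.

Fact qmulC : commutative qmul.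
Proof. by move=> x y; rewrite /qmul mulrC. Qed.

Fact qmul1 : left_id qone qmul.
Proof. by move=> x; rewrite -(qreprK x) -qprojM mul1r. Qed.

Fact qmulDl : left_distributive qmul +%R.
Proof.
move=> x y z; rewrite -(qreprK x) -(qreprK y) -(qreprK z).
by rewrite -raddfD -!qprojM mulrDl raddfD.
Qed.

HB.instance Definition _ := GRing.Zmodule_isComPzRing.Build quotalg
  qmulA qmulC qmul1 qmulDl.

Fact qscaleA a b x : qscale a (qscale b x) = qscale (a * b) x.
Proof. by rewrite -(qreprK x) -!qprojZ scalerA. Qed.

Fact qscale1 : left_id 1 qscale.
Proof. by move=> x; rewrite -(qreprK x) -!qprojZ scale1r. Qed.

Fact qscaleDr : right_distributive qscale +%R.
Proof.
move=> a x y; rewrite -(qreprK x) -(qreprK y).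
by rewrite -raddfD -!qprojZ scalerDr raddfD.
Qed.

Fact qscaleDl x : {morph qscale^~ x : a b / a + b}.
Proof. by move=> a b; rewrite -(qreprK x) -!qprojZ scalerDl raddfD. Qed.

HB.instance Definition _ := GRing.Zmodule_isLmodule.Build K quotalg
  qscaleA qscale1 qscaleDr qscaleDl.

End Quotient.

Definition quotalg_iso (K : fieldType) (R R' : comAlgType K)
    (I : ideal R) (I' : ideal R') : Prop :=
  exists f : {rmorphism quotalg I -> quotalg I'}, bijective f /\ scalable f.

Definition noetherian (A : comNzRingType) : Prop :=
  forall I : ideal A, exists s : seq A,
    forall x, I x <-> ideal_gen (fun y => y \in s) x.

Definition regular_seq (R : comNzRingType) (s : seq R) : Prop :=
  (forall i x, (i < size s)%N ->
     ideal_gen (fun y => y \in take i s) (s`_i * x) ->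
     ideal_gen (fun y => y \in take i s) x)
  /\ ~ ideal_gen (fun y => y \in s) 1.

Definition is_depth (R : comNzRingType) (I : ideal R) (d : nat) : Prop :=
  (exists s, [/\ regular_seq s, forall x, x \in s -> I x & size s = d])
  /\ forall s, regular_seq s -> (forall x, x \in s -> I x) -> (size s <= d)%N.

Record noethAlg (K : fieldType) := NoethAlg {
  noeth_alg :> comAlgType K;
  noethP : noetherian noeth_alg
}.

(* The value of the functor at [A] is the subset [fobj A] of [fcarrier A]. *)
Record functor_data (K : fieldType) := FunctorData {
  fcarrier : noethAlg K -> Type;
  fobj : forall A : noethAlg K, fcarrier A -> Prop;
  fmor : forall A B : noethAlg K,
    {lrmorphism A -> B} -> fcarrier A -> fcarrier B
}.

Arguments fobj {K} F A _ : rename.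
Arguments fmor {K} F {A B} phi _ : rename.

Section Functors.
Variable K : fieldType.
Implicit Types (A B : noethAlg K) (F G : functor_data K).

Definition is_functor F : Prop :=
  [/\ forall A B (phi : {lrmorphism A -> B}) x, fobj F A x ->
        fobj F B (fmor F phi x),
      forall A x, fobj F A x ->
        fmor F [the {lrmorphism A -> A} of idfun] x = x
    & forall A B (C : noethAlg K) (phi : {lrmorphism A -> B})
        (psi : {lrmorphism B -> C}) x, fobj F A x ->
        fmor F [the {lrmorphism A -> C} of psi \o phi] x
        = fmor F psi (fmor F phi x)].

Definition natural F G (eta : forall A, fcarrier F A -> fcarrier G A) : Prop :=
  (forall A x, fobj F A x -> fobj G A (eta A x))
  /\ forall A B (phi : {lrmorphism A -> B}) x, fobj F A x ->
       eta B (fmor F phi x) = fmor G phi (eta A x).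

Definition functor_iso F G (eta : forall A, fcarrier F A -> fcarrier G A) :
    Prop :=
  natural eta /\
  exists theta : forall A, fcarrier G A -> fcarrier F A,
    [/\ natural theta,
        forall A x, fobj F A x -> theta A (eta A x) = x
      & forall A y, fobj G A y -> eta A (theta A y) = y].

End Functors.

(* Terms of R = K[x_0,...,x_n] are elements of ['X_{1..n.+1}]; the variable x_i
   is the index [i : 'I_n.+1], and variables are compared through their index. *)

Section Terms.
Variable n : nat.
Local Notation term := 'X_{1..n.+1}.
Implicit Types (a m : term) (i : 'I_n.+1).

(* For the term 1 this is n, so that 1 has no non-multiplicative variable. *)
Definition tmin a : nat := \big[minn/n]_(i < n.+1 | a i != 0%N) i.

(* For the term 1 this is 0, so that [tmax 1 <= k] always holds. *)
Definition tmax a : nat := \max_(i < n.+1 | a i != 0%N) i.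

Definition nonmult a i : bool := (tmin a < i)%N.

Definition in_cone a m : bool :=
  (a <= m)%MM && [forall i, nonmult a i ==> ((m - a)%MM i == 0%N)].

Definition is_pommaret_basis (J : pred term) (P : {fset term}) : Prop :=
  [/\ forall m, J m <-> exists2 a, a \in P & (a <= m)%MM,
      forall a m, a \in P -> in_cone a m -> J m
    & forall m, J m -> exists! a, a \in P /\ in_cone a m].

Section Ideal.
Variables (K : fieldType) (J : ideal {mpoly K[n.+1]}).

Definition monomial_ideal : Prop :=
  exists T : term -> Prop, forall p,
    J p <-> ideal_gen (fun q => exists2 m, T m & q = 'X_[m]) p.

Definition terms : pred term := fun m => `[< J 'X_[m] >].

End Ideal.
End Terms.

(* [J] is the set of terms of a monomial ideal and [P] its Pommaret basis. *)

Section Marked.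
Variables (n : nat) (J : pred 'X_{1..n.+1}) (P : {fset 'X_{1..n.+1}}).

Section OverRing.
Variable A : comNzRingType.
Local Notation RA := {mpoly A[n.+1]}.

Definition in_span_N (p : RA) : Prop := forall m, m \in msupp p -> ~~ J m.

Definition complement_N (M : RA -> Prop) : Prop :=
  (forall p, exists q r, [/\ M q, in_span_N r & p = q + r])
  /\ forall p, M p -> in_span_N p -> p = 0.

Definition graded_ideal (M : RA -> Prop) : Prop :=
  is_ideal M /\ forall p d, M p -> M (pihomog mdeg d p).

Definition marked_set (F : {ffun P -> RA}) : Prop :=
  forall a : P, [/\ F a \is (mdeg (val a)).-homog, (F a)@_(val a) = 1
    & in_span_N (F a - 'X_[val a])].

Definition ideal_of_family (F : {ffun P -> RA}) : RA -> Prop :=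
  ideal_gen (fun p => exists a, p = F a).

Definition marked_basis (F : {ffun P -> RA}) (M : RA -> Prop) : Prop :=
  [/\ marked_set F, forall p, M p <-> ideal_of_family F p & complement_N M].

Definition syz (F : {ffun P -> RA}) : {ffun P -> RA^o} -> Prop :=
  fun g => \sum_a g a * F a = 0.

Definition Mf_syz_mem (MS : (RA -> Prop) * ({ffun P -> RA^o} -> Prop)) : Prop :=
  [/\ graded_ideal MS.1, complement_N MS.1
    & exists2 F, marked_basis F MS.1 & MS.2 = syz F].

Definition Mf_pi2_mem (S1 : {ffun P -> RA^o} -> Prop) : Prop :=
  exists M F, [/\ graded_ideal M, complement_N M, marked_basis F M
    & S1 = syz F].

End OverRing.

Section Extension.
Variables (A B : comNzRingType) (phi : {rmorphism A -> B}).

Definition ext_ideal (M : {mpoly A[n.+1]} -> Prop) : {mpoly B[n.+1]} -> Prop :=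
  ideal_gen (fun q => exists2 p, M p & q = map_mpoly phi p).

Definition ext_syz (S1 : {ffun P -> {mpoly A[n.+1]}^o} -> Prop) :
    {ffun P -> {mpoly B[n.+1]}^o} -> Prop :=
  @rspan {mpoly B[n.+1]} {ffun P -> {mpoly B[n.+1]}^o}
    (fun h => exists2 g : {ffun P -> {mpoly A[n.+1]}^o}, S1 g
       & h = [ffun a => map_mpoly phi (g a)]).

End Extension.

Variable K : fieldType.

Definition Mf_syz : functor_data K :=
  @FunctorData K
    (fun A => (({mpoly A[n.+1]} -> Prop) *
               ({ffun P -> {mpoly A[n.+1]}^o} -> Prop))%type)
    (fun A => @Mf_syz_mem A)
    (fun A B phi MS => (ext_ideal phi MS.1, ext_syz phi MS.2)).

Definition Mf_pi2 : functor_data K :=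
  @FunctorData K
    (fun A => {ffun P -> {mpoly A[n.+1]}^o} -> Prop)
    (fun A => @Mf_pi2_mem A)
    (fun A B phi S1 => ext_syz phi S1).

Definition pi2_map (A : noethAlg K) (MS : fcarrier Mf_syz A) :
  fcarrier Mf_pi2 A := MS.2.

(* A bound on all degrees involved, making the sets of parameters finite. *)
Definition dbound : nat := (\max_(a : P) mdeg (val a)).+2.

Definition Cidx : Type :=
  {c : P * 'X_{1..n.+1 < dbound} |
     ~~ J (bmnm c.2) && (mdeg (bmnm c.2) == mdeg (val c.1))}.

HB.instance Definition _ := Finite.on Cidx.

(* [J1 a m]: the term x^m f_a lies in J^(1). *)
Definition J1 (a : P) (m : 'X_{1..n.+1}) : bool :=
  [exists i : 'I_n.+1, nonmult (val a) i && (U_(i) <= m)%MM].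

(* The term x^m f_g belongs to s_{i,a}. *)
Definition in_s (i : 'I_n.+1) (a : P) (m : 'X_{1..n.+1}) (g : P) : bool :=
  [&& ~~ J1 g m, (tmax m <= minn i.-1 (tmin (val g)))%N
    & (mdeg m + mdeg (val g) == (mdeg (val a)).+1)%N].

Definition Bidx : Type :=
  {b : ('I_n.+1 * P) * ('X_{1..n.+1 < dbound} * P) |
     nonmult (val b.1.2) b.1.1 && in_s b.1.1 b.1.2 (bmnm b.2.1) b.2.2}.

HB.instance Definition _ := Finite.on Bidx.

(* Polynomial rings with a finite type of variables [V] are represented as
   polynomial rings in #|V| variables through [enum_rank]. *)
Definition pvar (V : finType) (v : V) : {mpoly K[#|V|]} := 'X_(enum_rank v).

Local Notation KB := {mpoly K[#|{: Bidx}|]}.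
Local Notation KBC := {mpoly K[#|{: Bidx + Cidx}|]}.

Definition Bvar (b : Bidx) : KBC := pvar (inl b : (Bidx + Cidx)%type).
Definition Cvar (c : Cidx) : KBC := pvar (inr c : (Bidx + Cidx)%type).

Definition inclB : KB -> KBC :=
  comp_mpoly [tuple Bvar (enum_val k) | k < #|{: Bidx}|].

HB.instance Definition _ := GRing.RMorphism.on inclB.

Definition genF (a : P) : {mpoly KBC[n.+1]} :=
  'X_[val a]
  - \sum_(c : Cidx | (val c).1 == a) Cvar c *: 'X_[bmnm (val c).2].

Definition gen_syz (i : 'I_n.+1) (a : P) : {mpoly KBC[n.+1]} :=
  'X_i * genF a
  - \sum_(b : Bidx | (val b).1 == (i, a))
      Bvar b *: ('X_[bmnm (val b).2.1] * genF (val b).2.2).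

Definition scrS : ideal KBC :=
  gen_ideal (fun x => exists i a m,
    nonmult (val a) i /\ x = (gen_syz i a)@_m).

Definition scrS_B : ideal KB := preim_ideal inclB scrS.

End Marked.

Arguments Mf_syz {n} J P K.
Arguments Mf_pi2 {n} J P K.
Arguments pi2_map {n} J P K A MS.
Arguments Cidx {n} J P.
Arguments Bidx {n} P.
Arguments Cvar {n J P} K c.
Arguments inclB {n} J P K _.
Arguments scrS {n} J P K.
Arguments scrS_B {n} J P K.

(* Main.v *)
Require Import Defs.
From HB Require Import structures.
From mathcomp Require Import all_boot all_order all_algebra.
From mathcomp Require Import ring zify.
From mathcomp Require Import finmap boolp.
From mathcomp Require Import ssrcomplements freeg mpoly.

Set Implicit Arguments.
Unset Strict Implicit.
Unset Printing Implicit Defensive.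

Import GRing.Theory.

Local Open Scope ring_scope.

(** Why the theorem holds.  Let F be a marked basis and write F_a for its element
    with head term x^a.  The rewriting of the products x_i F_a is a linear system
    in the F_a whose matrices involve only the parameters B; the claim is that, as
    soon as J has depth at least 2, this system determines F, through polynomial
    formulas in B.

    Depth at least 2 is used in the form: J = (1), or J contains powers of its two
    largest variables y = x_(n-1) and z = x_n ([depth2_pure_powers]).  In the main
    case exactly one element of the Pommaret basis has minimal variable z, namely
    a power z^d, with marked polynomial F_0.  Split the other elements into the low
    class, of minimal variable < y, and the middle class, of minimal variable y.

    - On the low class multiplication by y is non-multiplicative and its
      coefficients are free of y and z.  Cramer's rule gives a determinant D_T,
      monic in y and free of z, such that D_T F_a is a combination of the middle
      class and F_0.
    - On the middle class, of size u <= d, multiplication by D_T z then becomes a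
      linear map with coefficients free of z, modulo F_0.  Its characteristic
      determinant D_U = D_T^u z^u + (lower in z) sends the middle class into (F_0).
    - The ideal (F) contains an element E free of z and monic in y, by
      Cayley-Hamilton for multiplication by y on R/(F), which is finite over the
      ring of the smaller variables.  Hence r = D_U z^(d-u) - D_T^u F_0, of
      z-degree < d, satisfies r D_T E in (F_0); as F_0 is monic in z of degree d,
      r D_T E = 0, so r = 0.

    Thus D_T^u F_0 = D_U z^(d-u), where both determinants are built from the
    syzygies ([detT_lead]); dividing by the monic D_T recovers F_0.  In the same
    way D_A F_a = G_a F_0 for all other a, with D_A monic in z.  In other words,
    over fractions with denominators monic in y, the polynomial F_0 is the
    characteristic polynomial of z on (F)/(F_0).  Monic division keeps the
    coefficients in any subring containing the parameters ([elim_over]) and is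
    injective ([elim_uniq]).

    Over the quotient of K[B,C] by the ideal of syzygy equations, [elim_over]
    applied to the image of K[B] yields the polynomials q_c ([parameter_elim]),
    hence the isomorphism of quotient algebras ([param_quot_iso]).  Over an
    arbitrary algebra [elim_uniq] says that the syzygy module determines F; a
    marked basis always has syzygies of the prescribed shape
    ([marked_basis_syzygous]), because rewriting x_i F_a only uses products
    x^m F_g in which m is free of x_i and of all larger variables.  This gives the
    inverse of the second projection.  Functoriality holds because
    R_A = M + <N(J)> is a direct sum of free modules: normal forms modulo M, and
    expressions of elements of M in terms of F, are linear over A and survive base
    change ([ext_complement], [ext_syzE]). *)

(** * Subrings, determinants and division by monic polynomials *)

Lemma det_in (R : comNzRingType) (S : subringClosed R) s (M : 'M[R]_s) :
  (forall i j, M i j \in S) -> \det M \in S.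
Proof.
move=> MS; rewrite /determinant; apply: rpred_sum => σ _.
by rewrite rpredMsign; apply: rpred_prod => i _.
Qed.

Lemma adj_in (R : comNzRingType) (S : subringClosed R) s (M : 'M[R]_s) i j :
  (forall i j, M i j \in S) -> \adj M i j \in S.
Proof.
move=> MS; rewrite !mxE /cofactor rpredMsign; apply: det_in => k l.
by rewrite !mxE.
Qed.

Section Cramer.
Variables (R : comNzRingType) (I : finType) (T : {pred I}).
Variables (x : R) (N : I -> I -> R).

Definition sys_mx : 'M[R]_#|T| :=
  x%:M - \matrix_(r, s) N (enum_val r) (enum_val s).

Definition sys_adj (i k : I) : R :=
  \sum_(r | enum_val r == i) \sum_(s | enum_val s == k) \adj sys_mx r s.

(** Cramer's rule on the subset T of the index set; the matrix is indexed by
    ordinals, [sys_adj] is its adjugate read back on the original indices. *)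
Lemma cramer (F v : I -> R) :
    (forall i, i \in T -> x * F i = \sum_(j in T) N i j * F j + v i) ->
  forall i, i \in T ->
    \det sys_mx * F i = \sum_(k in T) sys_adj i k * v k.
Proof.
move=> rel i iT; pose Fc := \col_(r < #|T|) F (enum_val r).
pose vc := \col_(r < #|T|) v (enum_val r).
have eqv : sys_mx *m Fc = vc.
  apply/colP => r; rewrite mulmxBl mul_scalar_mx !mxE rel ?enum_valP //.
  rewrite big_enum_val /= addrAC -sumrB big1 ?add0r // => k _.
  by rewrite !mxE subrr.
have /colP/(_ (enum_rank_in iT i)) : (\det sys_mx)%:M *m Fc = \adj sys_mx *m vc.
  by rewrite -eqv mulmxA mul_adj_mx.
rewrite mul_scalar_mx [LHS]mxE [RHS]mxE [Fc _ _]mxE enum_rankK_in // => ->.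
rewrite [RHS]big_enum_val /=; apply: eq_bigr => k _; rewrite [vc _ _]mxE; congr (_ * _).
rewrite /sys_adj (big_pred1 (enum_rank_in iT i)) => [|r]; last first.
  by rewrite -[X in _ == X](enum_rankK_in iT iT) (inj_eq enum_val_inj).
by rewrite (big_pred1 k) // => s; rewrite (inj_eq enum_val_inj).
Qed.

Lemma sys_det_in (S : subringClosed R) :
  x \in S -> (forall i j, N i j \in S) -> \det sys_mx \in S.
Proof.
move=> xS NS; apply: det_in => r s.
by rewrite !mxE rpredB ?rpredMn.
Qed.

Lemma sys_adj_in (S : subringClosed R) i k :
  x \in S -> (forall i j, N i j \in S) -> sys_adj i k \in S.
Proof.
move=> xS NS; apply: rpred_sum => r _; apply: rpred_sum => s _.
by apply: adj_in => k' l; rewrite !mxE rpredB ?rpredMn.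
Qed.

End Cramer.

Section Degree.
Variables (n : nat) (A : comNzRingType).
Implicit Types (p q f : {mpoly A[n]}) (i : 'I_n) (m : 'X_{1..n}).

(** Degree in a single variable, expressed by vanishing coefficients so that no
    identification with univariate polynomials is needed. *)
Definition xdeg_lt i k p := forall m, (k <= m i)%N -> p@_m = 0.

Definition xmonic i k p := xdeg_lt i k (p - 'X_i ^+ k).

Lemma xdeg_ltD i k p q : xdeg_lt i k p -> xdeg_lt i k q -> xdeg_lt i k (p + q).
Proof. by move=> hp hq m mk; rewrite mcoeffD hp ?hq ?addr0. Qed.

Lemma xdeg_ltN i k p : xdeg_lt i k p -> xdeg_lt i k (- p).
Proof. by move=> hp m mk; rewrite mcoeffN hp ?oppr0. Qed.

Lemma xdeg_lt_sum i k (I : Type) (r : seq I) (P : pred I) (F : I -> {mpoly A[n]}) :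
  (forall j, P j -> xdeg_lt i k (F j)) -> xdeg_lt i k (\sum_(j <- r | P j) F j).
Proof.
move=> hF; elim/big_ind: _ => //; last exact: xdeg_ltD.
by move=> m _; rewrite mcoeff0.
Qed.

Lemma xdeg_ltW i k l p : (k <= l)%N -> xdeg_lt i k p -> xdeg_lt i l p.
Proof. by move=> kl hp m lm; apply: hp; apply: leq_trans lm. Qed.

Lemma xdeg_ltM i k l p q :
  xdeg_lt i k p -> xdeg_lt i l.+1 q -> xdeg_lt i (k + l) (p * q).
Proof.
move=> hp hq m mkl; rewrite mcoeffM big1 // => -[k1 k2] /= /eqP/mnmP em.
have := mkl; rewrite (em i) mnmDE.
case: (leqP k (k1 i)) => [k1i _|k1i]; first by rewrite hp ?mul0r.
move=> h; rewrite [q@__]hq ?mulr0 //.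
by rewrite -(ltn_add2l (k1 i)) (leq_trans _ h) // ltn_add2r.
Qed.

Lemma xdeg_ltX i k : xdeg_lt i k.+1 ('X_i ^+ k : {mpoly A[n]}).
Proof.
move=> m km; rewrite mcoeffXn; case: eqP => // em.
by move: km; rewrite -em mulmnE mnm1E eqxx mul1n ltnn.
Qed.

(** Division by a monic polynomial p, coefficient by coefficient from the top:
    the coefficient of p * f at m + k U_i is that of f at m, plus products of
    coefficients of p with coefficients of f of larger x_i-degree.  The set V is
    either 0, which gives regularity of p, or a subring, which gives descent of
    the coefficients. *)
Lemma xmonic_descent i k p f (V : A -> Prop) :
    xmonic i k p -> V 0 -> (forall x y, V x -> V y -> V (x - y)) ->
    (forall m x, V x -> V (p@_m * x)) ->
    (forall m, (k <= m i)%N -> V (p * f)@_m) -> forall m, V f@_m.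
Proof.
move=> pM V0 VB VM Vpf.
have VD x y : V x -> V y -> V (x + y).
  by move=> Vx Vy; rewrite -(opprK y) -(sub0r y); apply: (VB) (VB _ _ V0 Vy).
suff step e m : (msize f <= m i + e)%N -> V f@_m.
  by move=> m; apply: (step (msize f)); rewrite leq_addl.
elim: e m => [|e IH] m hm.
  rewrite memN_msupp_eq0 //; apply: contraL hm => /msize_mdeg_lt hm.
  rewrite -ltnNge addn0; apply: leq_ltn_trans hm.
  by rewrite mdegE (bigD1 i) //= leq_addr.
set q := p - 'X_i ^+ k in pM.
have := Vpf (m + U_(i) *+ k)%MM.
rewrite mnmDE mulmnE mnm1E eqxx mul1n leq_addl => /(_ isT).
rewrite -[p](subrK ('X_i ^+ k)) -/q mulrDl mcoeffD.
rewrite mpolyXn ['X_[_] * f]mulrC [(m + _)%MM]addmC mcoeffMX => Vs.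
suff Vq : V (q * f)@_(U_(i) *+ k + m)%MM.
  by rewrite -[f@_m](addrK (q * f)@_(U_(i) *+ k + m)%MM) [f@_m + _]addrC;
     apply: (VB).
rewrite mcoeffM; elim/big_ind: _ => // -[k1 k2] /= /eqP /mnmP/(_ i).
rewrite !mnmDE mulmnE mnm1E eqxx mul1n => ek.
case: (leqP k (k1 i)) => k1k; first by rewrite pM ?mul0r.
have -> : q@_k1 = p@_k1.
  rewrite mcoeffB mpolyXn mcoeffX; case: eqP => [ek1|]; last by rewrite subr0.
  by move: k1k; rewrite -ek1 mulmnE mnm1E eqxx mul1n ltnn.
apply/VM/IH; apply: leq_trans hm _; rewrite addnS -addSn leq_add2r.
by rewrite -(leq_add2l k) addnS ek -addSn leq_add2r.
Qed.

Lemma xmonic_reg_lt i k p f : xmonic i k p -> xdeg_lt i k (p * f) -> f = 0.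
Proof.
move=> pM pf; apply/mpolyP => m; rewrite mcoeff0.
apply: (xmonic_descent (V := fun x => x = 0) pM) => //.
- by move=> x y -> ->; rewrite subr0.
- by move=> ? x ->; rewrite mulr0.
Qed.

Lemma xmonic_reg i k p f : xmonic i k p -> p * f = 0 -> f = 0.
Proof.
by move=> pM pf; apply: (xmonic_reg_lt pM) => m _; rewrite pf mcoeff0.
Qed.

Lemma xmonic_over (S : subringClosed A) i k p f : xmonic i k p ->
  p \is a mpolyOver n S -> p * f \is a mpolyOver n S -> f \is a mpolyOver n S.
Proof.
move=> pM /mpolyOverP pS /mpolyOverP fS; apply/mpolyOverP => m.
apply: (xmonic_descent (V := fun x => x \in S) pM) => //.
- exact: rpred0.
- by move=> x y; apply: rpredB.
- by move=> m' x; apply: rpredM.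
Qed.

Definition lowvars (k : nat) : {pred {mpoly A[n]}} :=
  fun p => all (fun m : 'X_{1..n} =>
    [forall j : 'I_n, (k <= j)%N ==> (m j == 0%N)]) (msupp p).

Lemma lowvarsP k p :
  reflect (forall m (j : 'I_n), (k <= j)%N -> m j != 0%N -> p@_m = 0)
          (p \in lowvars k).
Proof.
apply: (iffP allP) => [h m j kj mj|h m].
  apply: memN_msupp_eq0; apply: contraNN mj => /h /forallP/(_ j).
  by rewrite kj.
rewrite mcoeff_msupp => pm; apply/forallP => j; apply/implyP => kj.
by apply: contraNT pm => mj; rewrite (h m j).
Qed.

Lemma lowvars_zmod k : zmod_closed (lowvars k).
Proof.
split=> [|p q /lowvarsP hp /lowvarsP hq]; apply/lowvarsP => m j kj mj.
  by rewrite mcoeff0.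
by rewrite mcoeffB (hp m j) ?(hq m j) ?subrr.
Qed.

Lemma lowvars_mul k : mulr_closed (lowvars k).
Proof.
split=> [|p q /lowvarsP hp /lowvarsP hq]; apply/lowvarsP => m j kj mj.
  by rewrite mcoeff1; case: eqP => [m0|]; first by rewrite m0 mnm0E in mj.
rewrite mcoeffM big1 // => -[k1 k2] /= /eqP/mnmP em.
move: mj; rewrite (em j) mnmDE addn_eq0 negb_and => /orP[] h.
  by rewrite (hp _ _ kj h) mul0r.
by rewrite (hq _ _ kj h) mulr0.
Qed.

HB.instance Definition _ k :=
  GRing.isZmodClosed.Build {mpoly A[n]} (lowvars k) (lowvars_zmod k).
HB.instance Definition _ k :=
  GRing.isMulClosed.Build {mpoly A[n]} (lowvars k) (lowvars_mul k).

Lemma lowvarsW k l p : (k <= l)%N -> p \in lowvars k -> p \in lowvars l.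
Proof.
move=> kl /lowvarsP hp; apply/lowvarsP => m j lj mj.
by apply: (hp m j) => //; apply: leq_trans lj.
Qed.

Lemma lowvars_xdeg i p : p \in lowvars i -> xdeg_lt i 1 p.
Proof. by move=> /lowvarsP hp m mi; apply: (hp m i) => //; rewrite -lt0n. Qed.

Lemma lowvarsX k m :
  (forall j : 'I_n, (k <= j)%N -> m j = 0%N) -> 'X_[m] \in lowvars k.
Proof.
move=> hm; apply/lowvarsP => m' j kj mj; rewrite mcoeffX.
by case: (m =P m') mj => // <-; rewrite hm.
Qed.

Lemma lowvarsZ k c p : p \in lowvars k -> c *: p \in lowvars k.
Proof.
move=> /lowvarsP hp; apply/lowvarsP => m j kj mj.
by rewrite mcoeffZ (hp m j) ?mulr0.
Qed.

(** The determinant is the characteristic polynomial of H evaluated at c x_i; its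
    coefficients are free of x_i because the entries of H are. *)
Lemma det_xlead i s (H : 'M[{mpoly A[n]}]_s) c :
    (forall r t, H r t \in lowvars i) -> c \in lowvars i ->
  xdeg_lt i s (\det ((c * 'X_i)%:M - H) - c ^+ s * 'X_i ^+ s).
Proof.
move=> HL cL.
have -> : \det ((c * 'X_i)%:M - H) = (char_poly H).[c * 'X_i].
  rewrite -horner_evalE /char_poly -det_map_mx; congr (\det _).
  apply/matrixP => r t; rewrite !mxE /= /horner_eval.
  by rewrite !(hornerE, hornerMn).
have cpL : char_poly H \is a polyOver (lowvars i).
  rewrite /char_poly; apply: det_in => r t.
  by rewrite !mxE rpredB ?rpredMn ?polyOverX ?polyOverC.
rewrite horner_coef size_char_poly big_ord_recr /=.
have -> : (char_poly H)`_s = 1.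
  by have /monicP := char_poly_monic H; rewrite lead_coefE size_char_poly.
rewrite mul1r exprMn addrK; apply: xdeg_lt_sum => j _.
rewrite exprMn mulrA; apply: (@xdeg_ltW _ (1 + j)); first by rewrite add1n.
apply: xdeg_ltM; last exact: xdeg_ltX.
apply: lowvars_xdeg; rewrite rpredM ?rpredX //.
exact: (polyOverP cpL).
Qed.

Lemma det_xmonic i s (H : 'M[{mpoly A[n]}]_s) :
  (forall r t, H r t \in lowvars i) -> xmonic i s (\det (('X_i)%:M - H)).
Proof.
move=> HL; have := det_xlead HL (rpred1 _).
by rewrite mul1r expr1n mul1r.
Qed.

End Degree.

(** * Elimination of a family from two linear systems *)

Section Elimination.
Variables (A : comNzRingType) (n : nat) (l1 l : 'I_n).
Variables (P : finType) (T U : {pred P}) (a0 : P) (d : nat).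
Variables N1 N : P -> P -> {mpoly A[n]}.
Local Notation RA := {mpoly A[n]}.

Hypothesis l1l : (l1 < l)%N.
Hypothesis TE : forall a, (a \in T) = ~~ ((a \in U) || (a == a0)).
Hypothesis U0 : a0 \notin U.
Hypothesis Ud : (#|U| <= d)%N.
Hypothesis N1low : forall a g, N1 a g \in @lowvars n A l1.
Hypothesis Nlow : forall a g, N a g \in @lowvars n A l.

(** The two systems and the two monic elements that make the family F
    recoverable from N and N1.  In the intended use a0 indexes the element with
    head term x_l^d, T and U the basis elements of minimal variable smaller than,
    respectively equal to, x_l1, and [elim_resultant] provides an element of the
    ideal of F free of x_l and monic in x_l1. *)
Record eliminable (F : P -> RA) : Prop := Eliminable {
  elim_top : forall a, a != a0 -> 'X_l * F a = \sum_g N a g * F g;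
  elim_low : forall a, a \in T -> 'X_l1 * F a = \sum_g N1 a g * F g;
  elim_monic : xmonic l d (F a0);
  elim_resultant : exists k (e : P -> RA),
    xmonic l1 k (\sum_g e g * F g) /\ \sum_g e g * F g \in @lowvars n A l }.

Definition detT : RA := \det (sys_mx T 'X_l1 N1).
Definition adjT (a g : P) : RA := \sum_(k in T) sys_adj T 'X_l1 N1 a k * N1 k g.
(** The matrix of multiplication by [detT * 'X_l] after the elements of T have
    been eliminated; only the columns outside T are meaningful. *)
Definition NU (a g : P) : RA := detT * N a g + \sum_(t in T) N a t * adjT t g.
Definition detU : RA := \det (sys_mx U (detT * 'X_l) NU).
Definition adjU (a : P) : RA :=
  \sum_(k in U) sys_adj U (detT * 'X_l) NU a k * NU k a0.
Definition detA : RA := \det (sys_mx (predC1 a0) 'X_l N).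
Definition adjA (a : P) : RA :=
  \sum_(k in predC1 a0) sys_adj (predC1 a0) 'X_l N a k * N k a0.

Lemma detT_low : detT \in @lowvars n A l.
Proof.
apply: sys_det_in => [|a g]; last exact: lowvarsW (ltnW l1l) (N1low a g).
by apply: lowvarsX => j lj; rewrite mnm1E; case: eqP lj l1l => // ->; case: ltngtP.
Qed.

Lemma adjT_low a g : adjT a g \in @lowvars n A l.
Proof.
apply: rpred_sum => k _; apply: rpredM.
  apply: sys_adj_in => [|b h]; last exact: lowvarsW (ltnW l1l) (N1low b h).
  by apply: lowvarsX => j lj; rewrite mnm1E; case: eqP lj l1l => // ->; case: ltngtP.
exact: lowvarsW (ltnW l1l) (N1low k g).
Qed.

Lemma NU_low a g : NU a g \in @lowvars n A l.
Proof.
rewrite rpredD ?rpredM ?detT_low //; apply: rpred_sum => t _.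
by rewrite rpredM ?adjT_low.
Qed.

Lemma detT_monic : xmonic l1 #|T| detT.
Proof. by apply: det_xmonic => r s; rewrite mxE. Qed.

Lemma detA_monic : xmonic l #|predC1 a0| detA.
Proof. by apply: det_xmonic => r s; rewrite mxE. Qed.

Lemma detU_lead : xdeg_lt l #|U| (detU - detT ^+ #|U| * 'X_l ^+ #|U|).
Proof.
by apply: det_xlead => [r s|]; rewrite ?mxE ?NU_low ?detT_low.
Qed.

Section Family.
Variables (F : P -> RA) (eF : eliminable F).

Lemma detT_rel a : a \in T -> detT * F a = \sum_(g | g \notin T) adjT a g * F g.
Proof.
move=> aT; pose v k := \sum_(g | g \notin T) N1 k g * F g.
rewrite (@cramer _ _ T 'X_l1 N1 F v) // => [|i iT]; last first.
  by rewrite (elim_low eF) // (bigID (mem T)).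
under eq_bigr do rewrite mulr_sumr; rewrite exchange_big /=.
by apply: eq_bigr => g _; rewrite [RHS]mulr_suml; apply: eq_bigr => k _; rewrite mulrA.
Qed.

Lemma detU_rel a : a \in U -> detU * F a = adjU a * F a0.
Proof.
move=> aU; rewrite (@cramer _ _ U (detT * 'X_l) NU F (fun k => NU k a0 * F a0)) //.
  by rewrite [RHS]mulr_suml; apply: eq_bigr => k _; rewrite mulrA.
move=> {aU}a aU.
have -> : detT * 'X_l * F a = \sum_(g | g \notin T) NU a g * F g.
  rewrite -mulrA (elim_top eF); last by apply: contraNneq U0 => <-.
  rewrite (bigID (mem T)) /= mulrDr mulr_sumr.
  have -> : \sum_(g in T) detT * (N a g * F g)
          = \sum_(g in T) \sum_(h | h \notin T) N a g * (adjT g h * F h).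
    by apply: eq_bigr => g gT; rewrite mulrCA detT_rel // mulr_sumr.
  rewrite exchange_big mulr_sumr -big_split /=; apply: eq_bigr => g _.
  rewrite /NU mulrDl addrC mulrA mulr_suml; congr (_ + _).
  by apply: eq_bigr => t _; rewrite mulrA.
rewrite (bigD1 a0) /=; last by rewrite TE eqxx orbT.
rewrite addrC; congr (_ + _); apply: eq_bigl => g.
by rewrite TE negbK; case: eqP => [->|]; rewrite ?andbF ?(negbTE U0) ?orbF ?andbT.
Qed.

Lemma detA_rel a : a != a0 -> detA * F a = adjA a * F a0.
Proof.
move=> aa0; rewrite (@cramer _ _ (predC1 a0) 'X_l N F (fun k => N k a0 * F a0)) //.
  by rewrite [RHS]mulr_suml; apply: eq_bigr => k _; rewrite mulrA.
by move=> i ia0; rewrite (elim_top eF) // (bigD1 a0) //= addrC.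
Qed.

(** All of (F) is sent into (F a0) by one element depending on N and N1 only. *)
Lemma detTU_rel a : exists h, detT * detU * F a = h * F a0.
Proof.
have relU b : (b \in U) || (b == a0) -> exists h, detU * F b = h * F a0.
  case/orP=> [bU|/eqP->]; last by exists detU.
  by exists (adjU b); rewrite detU_rel.
have [aT|] := boolP (a \in T); last first.
  rewrite TE negbK => /relU [h eh]; exists (detT * h).
  by rewrite -!mulrA eh.
have /choice [h eh] g : exists h, g \notin T -> detU * F g = h * F a0.
  have [_|] := boolP (g \in T); first by exists 0.
  by rewrite TE negbK => /relU [h eh]; exists h.
exists (\sum_(g | g \notin T) adjT a g * h g).
rewrite mulrAC detT_rel // [LHS]mulr_suml [RHS]mulr_suml; apply: eq_bigr => g gT.
by transitivity (adjT a g * (detU * F g)); [ring | rewrite eh //; ring].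
Qed.

(** [detU] and [detT ^+ u * F a0] have the same leading part in x_l, up to a
    power of x_l.  Their difference r has degree < d, while r times a polynomial
    free of x_l lies in the ideal of F a0, which is monic of degree d; so r is
    zero once that polynomial is known to be regular. *)
Lemma detT_lead : detT ^+ #|U| * F a0 = detU * 'X_l ^+ (d - #|U|).
Proof.
set u := #|U|; apply/eqP; rewrite eq_sym -subr_eq0; apply/eqP.
set r := _ - _; have [k [e]] := elim_resultant eF; set E := \sum_g _ => -[EM El].
have rlt : xdeg_lt l d r.
  have -> : r = (detU - detT ^+ u * 'X_l ^+ u) * 'X_l ^+ (d - u)
              - detT ^+ u * (F a0 - 'X_l ^+ d).
    rewrite /r -{3}(subnKC Ud) exprD; ring.
  apply: xdeg_ltD; last apply: xdeg_ltN.
    rewrite -{1}(subnKC Ud); apply: xdeg_ltM; [exact: detU_lead|exact: xdeg_ltX].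
  rewrite mulrC -[d in xdeg_lt _ d]addn0; apply: xdeg_ltM.
    exact: elim_monic eF.
  by apply: lowvars_xdeg; rewrite rpredX ?detT_low.
have [h eh] : exists h, r * (detT * E) = F a0 * h.
  have /choice [h eh] := detTU_rel.
  exists ('X_l ^+ (d - u) * (\sum_g e g * h g) - detT ^+ u * detT * E).
  have -> : r * (detT * E) = 'X_l ^+ (d - u) * (detT * detU * E)
      - F a0 * (detT ^+ u * detT * E) by rewrite /r; ring.
  rewrite [RHS]mulrBr; congr (_ - _).
  rewrite [RHS]mulrCA /E; congr (_ * _); rewrite [LHS]mulr_sumr [RHS]mulr_sumr.
  by apply: eq_bigr => g _; rewrite [LHS]mulrCA eh; ring.
have h0 : h = 0.
  apply: (xmonic_reg_lt (elim_monic eF)); rewrite -eh -[d]addn0.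
  by apply: xdeg_ltM rlt _; apply: lowvars_xdeg; rewrite rpredM ?detT_low.
apply: (xmonic_reg EM); apply: (xmonic_reg detT_monic).
by rewrite mulrA mulrC eh h0 mulr0.
Qed.

End Family.

(** Every polynomial in sight other than F is a polynomial expression in the
    entries of N and N1, and F is obtained from these by monic divisions. *)
Lemma elim_over (S : subringClosed A) (F : P -> RA) : eliminable F ->
  (forall a g, N a g \is a mpolyOver n S) ->
  (forall a g, N1 a g \is a mpolyOver n S) ->
  forall a, F a \is a mpolyOver n S.
Proof.
move=> eF NS N1S.
have XS i : 'X_i \is a mpolyOver n S by exact: mpolyOverX.
have dTS : detT \is a mpolyOver n S by apply: sys_det_in.
have aTS a g : adjT a g \is a mpolyOver n S.
  by apply: rpred_sum => k _; rewrite rpredM //; apply: sys_adj_in.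
have NUS a g : NU a g \is a mpolyOver n S.
  by rewrite rpredD ?rpredM //; apply: rpred_sum => t _; rewrite rpredM.
have dUS : detU \is a mpolyOver n S by apply: sys_det_in; rewrite ?rpredM.
have F0S : F a0 \is a mpolyOver n S.
  have : detT ^+ #|U| * F a0 \is a mpolyOver n S.
    by rewrite detT_lead // rpredM ?rpredX.
  elim: #|U| => [|u IH]; first by rewrite mul1r.
  by rewrite exprS -mulrA => /(xmonic_over detT_monic dTS)/IH.
move=> a; have [->//|aa0] := eqVneq a a0.
apply: (xmonic_over detA_monic); first by apply: sys_det_in.
rewrite detA_rel // rpredM //; apply: rpred_sum => k _.
by rewrite rpredM //; apply: sys_adj_in.
Qed.

Lemma elim_uniq (F F' : P -> RA) : eliminable F -> eliminable F' -> F =1 F'.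
Proof.
move=> eF eF'.
have F0 : F a0 = F' a0.
  apply/subr0_eq; have : detT ^+ #|U| * (F a0 - F' a0) = 0.
    by rewrite mulrBr !detT_lead // subrr.
  elim: #|U| => [|u IH]; first by rewrite mul1r.
  by rewrite exprS -mulrA => /(xmonic_reg detT_monic)/IH.
move=> a; have [->//|aa0] := eqVneq a a0.
apply/subr0_eq/(xmonic_reg detA_monic).
by rewrite mulrBr !detA_rel // F0 subrr.
Qed.

End Elimination.

(** * Pommaret cones *)

Section Cones.
Variable n : nat.
Local Notation term := 'X_{1..n.+1}.
Implicit Types (a g m : term) (i j : 'I_n.+1).

Lemma nonmultP a i :
  reflect (exists2 j : 'I_n.+1, (j < i)%N & a j != 0%N) (nonmult a i).
Proof.
rewrite /nonmult /tmin; apply: (iffP idP) => [|[j ji aj]].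
  elim/big_ind: _ => [|x y hx hy|j aj ji]; last by exists j.
    by rewrite ltnNge -ltnS ltn_ord.
  by rewrite gtn_min => /orP[].
apply: leq_ltn_trans ji; elim: (index_enum _) (mem_index_enum j) => // k r IH.
rewrite inE big_cons => /predU1P[<-|/IH {}IH]; first by rewrite aj geq_minl.
by case: ifP => // _; apply: leq_trans (geq_minr _ _) IH.
Qed.

Lemma nonmult_free a i j : ~~ nonmult a i -> (j < i)%N -> a j = 0%N.
Proof.
by move=> /nonmultP h ji; apply/eqP; apply: contra_notT h => aj; exists j.
Qed.

Lemma in_coneP a m : reflect
  ((a <= m)%MM /\ forall i, nonmult a i -> m i = a i) (in_cone a m).
Proof.
apply: (iffP andP) => -[am h]; split=> //.
  move=> i ai; have /implyP/(_ ai) := forallP h i.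
  by rewrite mnmBE subn_eq0 => mi; apply/eqP; rewrite eqn_leq mi (mnm_lepP am).
apply/forallP => i; apply/implyP => /h mi.
by rewrite mnmBE mi subnn.
Qed.

Lemma in_cone_refl a : in_cone a a.
Proof. by apply/in_coneP; split=> //; apply: lepm_refl. Qed.

(** A variable of the cofactor m / a is multiplicative for a, so that a has no
    smaller variable. *)
Lemma in_cone_free a m i j :
  in_cone a m -> a i != m i -> (j < i)%N -> a j = 0%N.
Proof.
move=> /in_coneP[_ h] ai ji; apply: (@nonmult_free _ i) => //.
by apply: contraNN ai => /h ->.
Qed.

Lemma in_cone_drop a m i :
  in_cone a (U_(i) + m)%MM -> (a i <= m i)%N -> in_cone a m.
Proof.
move=> /in_coneP[/mnm_lepP am h] ai; apply/in_coneP; split.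
  apply/mnm_lepP => j; have := am j; rewrite mnmDE mnm1E.
  by case: eqP => [<- _|].
move=> j aj; have := h j aj; rewrite mnmDE mnm1E; case: eqP => // eij.
by subst j; move=> e; rewrite -e add1n ltnn in ai.
Qed.

Definition wgt (d : nat) m : nat := \sum_(j < n.+1) m j * d.+1 ^ j.

(** [wgt d] reads exponents as digits in base d + 1, the largest variable being
    the most significant; it turns the lexicographic descent of cofactors into
    one of natural numbers. *)
Lemma wgt_lt d m m' (l : 'I_n.+1) : (mdeg m' <= d)%N -> (m' l < m l)%N ->
  (forall j : 'I_n.+1, (l < j)%N -> m' j = 0%N) -> (wgt d m' < wgt d m)%N.
Proof.
move=> md ml m0.
have -> : wgt d m' = (m' l * d.+1 ^ l
    + \sum_(j < n.+1 | (j < l)%N) m' j * d.+1 ^ j)%N.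
  rewrite /wgt (bigD1 l) //=; congr (_ + _)%N.
  rewrite (bigID (fun j : 'I_n.+1 => (j < l)%N)) /= [X in (_ + X)%N]big1.
    rewrite addn0; apply: eq_bigl => j; case: ltngtP => //=; rewrite ?andbF //.
    by move=> jl; rewrite andbT; apply/eqP => e; rewrite e ltnn in jl.
  move=> j /andP[jl]; rewrite -leqNgt leq_eqVlt => /orP[/eqP/val_inj e|/m0 ->//].
  by rewrite e eqxx in jl.
have low : (\sum_(j < n.+1 | (j < l)%N) m' j * d.+1 ^ j < d.+1 ^ l)%N.
  rewrite -(ltn_pmul2l (ltn0Sn d)).
  apply: leq_ltn_trans (_ : (d * d.+1 ^ l < _)%N); last first.
    by rewrite ltn_pmul2r ?expn_gt0.
  apply: leq_trans (_ : (\sum_(j < n.+1 | (j < l)%N) m' j * d.+1 ^ l <= _)%N).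
    rewrite big_distrr /=; apply: leq_sum => j jl.
    by rewrite mulnCA leq_mul2l -expnS leq_pexp2l ?jl ?orbT.
  rewrite -big_distrl /= leq_mul2r; apply/orP; right; apply: leq_trans md.
  by rewrite mdegE [X in (_ <= X)%N](bigID (fun j : 'I_n.+1 => (j < l)%N)) leq_addr.
apply: (@leq_trans ((m' l).+1 * d.+1 ^ l)); first by rewrite mulSn addnC ltn_add2r.
apply: (@leq_trans (m l * d.+1 ^ l)); first by rewrite leq_mul2r ml orbT.
by rewrite /wgt (bigD1 l) //= leq_addr.
Qed.

Section Basis.
Variables (J : pred term) (P : {fset term}) (hP : is_pommaret_basis J P).

Lemma pommaret_dvd a m : a \in P -> (a <= m)%MM -> J m.
Proof. by have [h _ _] := hP => aP am; apply/h; exists a. Qed.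

Lemma pommaret_mem a : a \in P -> J a.
Proof. by move=> aP; apply: pommaret_dvd (lepm_refl a). Qed.

Lemma terms_up m m' : J m -> (m <= m')%MM -> J m'.
Proof.
have [h _ _] := hP => /h[a aP am] mm'.
exact: pommaret_dvd aP (lepm_trans am mm').
Qed.

Lemma pommaret_cone m : J m -> exists2 a, a \in P & in_cone a m.
Proof. by have [_ _ h] := hP => /h[a [[aP am] _]]; exists a. Qed.

Lemma pommaret_uniq a g m :
  a \in P -> g \in P -> in_cone a m -> in_cone g m -> a = g.
Proof.
have [_ hJ h] := hP => aP gP am gm.
by have [c [_ cu]] := h m (hJ _ _ aP am); rewrite -(cu a) // (cu g).
Qed.

(** If x_i, or a larger variable, divided the cofactor, then x_i would divide it
    and be multiplicative for g, so that m itself would lie in the cone of g.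
    This contradicts m being outside J, or m being a basis element other than g,
    or x_i being non-multiplicative for m = g. *)
Lemma prolong_low i m g (j : 'I_n.+1) :
    ~~ J m \/ m \in P /\ nonmult m i -> g \in P ->
    in_cone g (U_(i) + m)%MM -> (i <= j)%N ->
  (U_(i) + m - g)%MM j = 0%N.
Proof.
move=> hm gP gm ij; apply/eqP; apply: contraT => ej.
have ne k : (U_(i) + m - g)%MM k != 0%N -> g k != (U_(i) + m)%MM k.
  by rewrite mnmBE subn_eq0 -ltnNge; case: ltngtP.
have gi : (g i <= m i)%N.
  move: ij; rewrite leq_eqVlt => /orP[/eqP/val_inj e|ij].
    move: ej; rewrite -e mnmBE mnmDE mnm1E eqxx; lia.
  by rewrite (in_cone_free gm (ne _ ej) ij).
have gm' := in_cone_drop gm gi; case: hm => [|[mP mi]].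
  by apply: contraNT => _; apply: pommaret_dvd gP (proj1 (in_coneP _ _ gm')).
have e := pommaret_uniq gP mP gm' (in_cone_refl m); subst g.
have [_ /(_ i mi)] := in_coneP _ _ gm; rewrite mnmDE mnm1E eqxx; lia.
Qed.

(** The new cofactor is lexicographically smaller than m.  It is not a multiple
    of m, as otherwise g would divide b; so it drops below m at some index l.  If
    it involved x_j with j > l, then g would be free of x_l and the cofactor would
    keep the whole exponent of m + b there. *)
Lemma cone_lower m b g : ~~ J b -> g \in P -> in_cone g (m + b)%MM ->
  exists2 l : 'I_n.+1, ((m + b - g)%MM l < m l)%N
    & forall j : 'I_n.+1, (l < j)%N -> (m + b - g)%MM j = 0%N.
Proof.
move=> bJ gP gm; have [gle _] := in_coneP _ _ gm.
have : ~~ (m <= m + b - g)%MM.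
  apply: contraNN bJ => /mnm_lepP mle; apply: (pommaret_dvd gP).
  apply/mnm_lepP => k; have := mle k; have := mnm_lepP gle k.
  by rewrite mnmBE mnmDE; lia.
rewrite negb_forall => /existsP[l]; rewrite -ltnNge => ml; exists l => // j lj.
apply/eqP; apply: contraLR ml; rewrite -leqNgt mnmBE subn_eq0 -ltnNge => ej.
have gj : g j != (m + b)%MM j by case: ltngtP ej.
by rewrite mnmBE (in_cone_free gm gj lj) subn0 mnmDE leq_addr.
Qed.

End Basis.
End Cones.

(** * Rewriting by a marked set *)

Definition is_submodule (R : nzRingType) (V : lmodType R) (W : V -> Prop) :=
  [/\ W 0, forall p q, W p -> W q -> W (p + q) & forall c p, W p -> W (c *: p)].

Section Spans.
Variables (n : nat) (A : comNzRingType).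
Local Notation RA := {mpoly A[n]}.


Lemma submodule_sub (W : RA -> Prop) p q : is_submodule W -> W p -> W q -> W (p - q).
Proof. by case=> _ WD WZ Wp Wq; rewrite -scaleN1r; apply/WD/WZ. Qed.

Lemma submodule_mulX (W : RA -> Prop) m p : is_submodule W ->
  (forall b, p@_b != 0 -> W 'X_[m + b]) -> W ('X_[m] * p).
Proof.
case=> W0 WD WZ h; rewrite [p]mpolyE mulr_sumr big_seq.
elim/big_ind: _ => // b; rewrite mcoeff_msupp => /h Wb.
by rewrite -scalerAr -mpolyXD; apply: WZ.
Qed.

Lemma submodule_full (W : RA -> Prop) p : is_submodule W ->
  (forall b, p@_b != 0 -> W 'X_[b]) -> W p.
Proof.
move=> hW h; rewrite -[p]mul1r -mpolyX0; apply: submodule_mulX => // b.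
by rewrite add0m; apply: h.
Qed.

End Spans.

Section Marked.
Variables (n : nat) (J : pred 'X_{1..n.+1}) (P : {fset 'X_{1..n.+1}}).
Hypothesis hP : is_pommaret_basis J P.

Section OverRing.
Variable A : comNzRingType.
Local Notation RA := {mpoly A[n.+1]}.
Local Notation term := 'X_{1..n.+1}.

Lemma in_span_N_submodule : is_submodule (@in_span_N n J A).
Proof.
split=> [m|p q hp hq m|c p hp m]; rewrite mcoeff_msupp.
- by rewrite mcoeff0 eqxx.
- rewrite mcoeffD => pq; have [p0|] := eqVneq p@_m 0; last first.
    by rewrite -mcoeff_msupp => /hp.
  by apply: hq; rewrite mcoeff_msupp; rewrite p0 add0r in pq.
- rewrite mcoeffZ => cp; apply: hp; rewrite mcoeff_msupp.
  by apply: contraNneq cp => ->; rewrite mulr0.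
Qed.

Lemma in_span_N_X m : ~~ J m -> @in_span_N n J A 'X_[m].
Proof. by move=> mJ m'; rewrite msuppX inE => /eqP->. Qed.

Definition family_span (F : P -> RA) (p : RA) : Prop :=
  exists e : P -> RA, p = \sum_g e g * F g.

Lemma ideal_of_familyE (F : {ffun P -> RA}) p :
  ideal_of_family F p <-> family_span F p.
Proof.
split=> [[k [c [h [hF ->]]]]|[e ->]].
  have /choice[a ea] := hF.
  exists (fun g => \sum_(i | a i == g) c i).
  rewrite (partition_big a predT) //=; apply: eq_bigr => g _.
  by rewrite mulr_suml; apply: eq_bigr => i /eqP <-; rewrite ea.
exists #|{: P}|, (fun r => e (enum_val r)), (fun r => F (enum_val r)).
split=> [r|]; first by exists (enum_val r).
by rewrite -(big_enum_val (A := predT) (fun g => e g * F g)) /=.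
Qed.

Lemma family_span_ideal F : is_ideal (family_span F).
Proof.
split=> [|p q [e ->] [e' ->]|a p [e ->]].
- by exists (fun=> 0); rewrite big1 // => g _; rewrite mul0r.
- exists (fun g => e g + e' g); rewrite -big_split.
  by apply: eq_bigr => g _; rewrite mulrDl.
- exists (fun g => a * e g); rewrite mulr_sumr.
  by apply: eq_bigr => g _; rewrite mulrA.
Qed.

Lemma family_span_mem F g : family_span F (F g).
Proof.
exists (fun h => (h == g)%:R); rewrite (bigD1 g) //= eqxx mul1r big1 ?addr0 //.
by move=> h /negbTE->; rewrite mul0r.
Qed.

Lemma ideal_submodule (M : RA -> Prop) : is_ideal M -> is_submodule M.
Proof. by case=> M0 MD MM; split=> // c p Mp; rewrite -mul_mpolyC; apply: MM. Qed.

Section Family.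
Variables (F : {ffun P -> RA}) (hF : marked_set J F).

Lemma marked_tail (g : P) b : (F g - 'X_[val g])@_b != 0 ->
  ~~ J b /\ mdeg b = mdeg (val g).
Proof.
have [Fh _ FN] := hF g; rewrite -mcoeff_msupp => bs; split; first exact: FN.
have th : F g - 'X_[val g] \is (mdeg (val g)).-homog.
  by rewrite rpredB ?dhomogX.
exact: dhomog_mf th _ bs.
Qed.

(** One reduction: the marked polynomial trades its head term for its tail. *)
Lemma rewrite_step (W : RA -> Prop) m (g : P) : is_submodule W ->
    W ('X_[m] * F g) ->
    (forall b, ~~ J b -> mdeg b = mdeg (val g) -> W 'X_[m + b]) ->
  W 'X_[m + val g].
Proof.
move=> hW WF h.
have -> : 'X_[m + val g] = 'X_[m] * F g - 'X_[m] * (F g - 'X_[val g]) :> RA.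
  by rewrite mpolyXD; ring.
apply: submodule_sub => //; apply: submodule_mulX => // b.
by case/marked_tail; apply: h.
Qed.

(** The products x^m F_g, of degree D, into which terms are rewritten: m is
    multiplicative for g, and the bound k on its variables is what distinguishes
    the sets of parameters B from arbitrary reductions. *)
Definition reducer (k D : nat) (g : P) (m : term) : Prop :=
  [/\ forall j : 'I_n.+1, (k <= j)%N -> m j = 0%N,
      forall j, nonmult (val g) j -> m j = 0%N
    & (mdeg m + mdeg (val g))%N = D].

Lemma cone_reducer k D (g : P) m : in_cone (val g) m -> mdeg m = D ->
  (forall j : 'I_n.+1, (k <= j)%N -> (m - val g)%MM j = 0%N) ->
  reducer k D g (m - val g)%MM.
Proof.
move=> /in_coneP[gm h] mD mk; split=> // [j /h mj|].
  by rewrite mnmBE mj subnn.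
by rewrite -mdegD submK.
Qed.

(** Rewriting terminates and never introduces in the cofactors a variable larger
    than those of m, as each step lowers the cofactor lexicographically.  It is
    phrased with a submodule W so as to serve both for the generation of the ring
    and for the precise shape of the syzygies. *)
Lemma rewrite_low k D (W : RA -> Prop) : is_submodule W ->
    (forall g m, reducer k D g m -> W ('X_[m] * F g)) ->
    (forall b, ~~ J b -> mdeg b = D -> W 'X_[b]) ->
  forall m b, ~~ J b -> (mdeg m + mdeg b)%N = D ->
    (forall j : 'I_n.+1, (k <= j)%N -> m j = 0%N) -> W 'X_[m + b].
Proof.
move=> hW WF WN m; have [w le_w] := ubnP (wgt D m).
elim: w m le_w => // w IH m le_w b bJ mbD mk.
have [mbJ|] := boolP (J (m + b)%MM); last by move/WN; apply; rewrite mdegD.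
have [g gP gm] := pommaret_cone hP mbJ.
pose g' : P := [` gP]%fset; have [gle _] := in_coneP _ _ gm.
have [l lm l0] := cone_lower hP bJ gP gm.
have m'k (j : 'I_n.+1) : (k <= j)%N -> (m + b - g)%MM j = 0%N.
  move=> kj; apply: l0; rewrite ltnNge; apply/negP => jl.
  by move: lm; rewrite (mk l) // (leq_trans kj).
have red : reducer k D g' (m + b - g) by apply: cone_reducer => //; rewrite mdegD.
rewrite -(submK gle); apply: (rewrite_step (g := g')) => // [|c cJ cg].
  exact: WF.
have [_ _ degD] := red.
apply: IH => //; last by rewrite cg.
apply: leq_trans (_ : (wgt D m <= w)%N); last by rewrite -ltnS.
by apply: wgt_lt lm l0; rewrite -degD leq_addr.
Qed.

(** Every term m is m times the term 1, which is a normal form unless J is the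
    whole ring. *)
Lemma marked_generates p : ~~ J 0%MM ->
  exists q r, [/\ family_span F q, in_span_N J r & p = q + r].
Proof.
move=> J0; pose W p := exists q r, [/\ family_span F q, in_span_N J r & p = q + r].
have [N0 ND NZ] := in_span_N_submodule.
have [M0 MD MZ] := ideal_submodule (family_span_ideal F).
have [_ _ MM] := family_span_ideal F.
have hW : is_submodule W.
  split=> [|_ _ [q [r [hq hr ->]]] [q' [r' [hq' hr' ->]]]|c _ [q [r [hq hr ->]]]].
  - by exists 0, 0; rewrite addr0.
  - by exists (q + q'), (r + r'); rewrite addrACA; split; [apply: MD|apply: ND|].
  - by exists (c *: q), (c *: r); rewrite scalerDr; split; [apply: MZ|apply: NZ|].
apply: (submodule_full (W := W)) => // m _; rewrite -[m]addm0.
apply: (@rewrite_low n.+1 (mdeg m)) => // [g m' _|b bJ _||j].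
- exists ('X_[m'] * F g), 0; rewrite addr0; split=> //.
  exact/MM/family_span_mem.
- by exists 0, 'X_[b]; rewrite add0r; split=> //; apply: in_span_N_X.
- by rewrite mdeg0 addn0.
- by rewrite leqNgt ltn_ord.
Qed.

End Family.

(** The entries of the matrix of multiplication by x_i on the family; they are
    free of x_i because the cofactors indexed by [Bidx] only use smaller
    variables. *)
Definition rel_coef (b : Bidx P -> A) (i : 'I_n.+1) (a g : P) : RA :=
  \sum_(c : Bidx P | ((val c).1 == (i, a)) && ((val c).2.2 == g))
     b c *: 'X_[bmnm (val c).2.1].

Definition syzygous (b : Bidx P -> A) (F : P -> RA) : Prop :=
  forall i a, nonmult (val a) i -> 'X_i * F a = \sum_g rel_coef b i a g * F g.

Lemma rel_coefE b i a (F : P -> RA) :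
  \sum_g rel_coef b i a g * F g =
  \sum_(c : Bidx P | (val c).1 == (i, a))
     b c *: ('X_[bmnm (val c).2.1] * F (val c).2.2).
Proof.
rewrite [RHS](partition_big (fun c : Bidx P => (val c).2.2) predT) //=.
apply: eq_bigr => g _; rewrite mulr_suml; apply: eq_bigr => c /andP[_ /eqP ->].
by rewrite scalerAl.
Qed.

Lemma rel_coef_low b (i : 'I_n.+1) a g : rel_coef b i a g \in @lowvars n.+1 A i.
Proof.
apply: rpred_sum => c /andP[/eqP ec _]; apply: lowvarsZ; apply: lowvarsX => j ij.
have /andP[] := valP c; rewrite ec /= => ai /and3P[_ tm _].
apply/eqP; apply: contraTT tm => mj; rewrite -ltnNge.
apply: (@leq_ltn_trans i.-1); first exact: geq_minl.
apply: (@leq_trans j); last by rewrite /tmax (bigD1 j) //= leq_maxl.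
by apply: leq_trans ij; rewrite prednK // (leq_ltn_trans _ ai).
Qed.

Lemma rel_coef_over (S : subringClosed A) b i a g :
  (forall c, b c \in S) -> rel_coef b i a g \is a mpolyOver n.+1 S.
Proof.
move=> bS; apply: rpred_sum => c _; apply: mpolyOverZ => //.
exact: mpolyOverX.
Qed.

Lemma reducer_in_s (i : 'I_n.+1) (a g : P) m : nonmult (val a) i ->
    reducer i (mdeg (val a)).+1 g m ->
  exists2 c : Bidx P, (val c).1 = (i, a) & (bmnm (val c).2.1, (val c).2.2) = (m, g).
Proof.
move=> ai [mi mg md].
have mb : (mdeg m < dbound P)%N.
  rewrite /dbound ltnS (leq_trans (leq_addr (mdeg (val g)) _)) // md ltnS.
  by rewrite (bigD1 a) //= leq_maxl.
have cP : nonmult (val a) i && in_s i a m g.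
  rewrite ai /in_s md eqxx andbT /=; apply/andP; split.
    apply/existsP => -[j /andP[gj]]; rewrite lep1mP => /negP; apply.
    by rewrite mg.
  apply/bigmax_leqP => j mj; rewrite leq_min; apply/andP; split.
    have ji : (j < i)%N by rewrite ltnNge; apply: contraNN mj => /mi->.
    by rewrite -ltnS prednK // (leq_ltn_trans _ ji).
  by rewrite leqNgt; apply: contraNN mj => /mg->.
by exists (exist _ ((i, a), (BMultinom mb, g)) cP).
Qed.

(** All the terms of x_i F_a have the form x_i m with m a normal form or m = a, so
    by [prolong_low] their first reduction only uses cofactors in the variables
    below x_i, and [rewrite_low] preserves this. *)
Lemma prolong_rewrite (F : {ffun P -> RA}) i (a : P) : marked_set J F ->
    nonmult (val a) i ->
  exists (b : Bidx P -> A) r, in_span_N J r /\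
    'X_i * F a = \sum_(c : Bidx P | (val c).1 == (i, a))
       b c *: ('X_[bmnm (val c).2.1] * F (val c).2.2) + r.
Proof.
move=> hF ai; pose D := (mdeg (val a)).+1.
pose W p := exists (b : Bidx P -> A) r, in_span_N J r /\
    p = \sum_(c : Bidx P | (val c).1 == (i, a))
       b c *: ('X_[bmnm (val c).2.1] * F (val c).2.2) + r.
have [N0 ND NZ] := in_span_N_submodule.
have hW : is_submodule W.
  split=> [|_ _ [b [r [hr ->]]] [b' [r' [hr' ->]]]|c _ [b [r [hr ->]]]].
  - exists (fun=> 0), 0; split=> //.
    by rewrite big1 ?addr0 // => c _; rewrite scale0r.
  - exists (fun c => b c + b' c), (r + r'); split; first exact: ND.
    rewrite addrACA -big_split; congr (_ + _).
    by apply: eq_bigr => c _; rewrite scalerDl.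
  - exists (fun d => c * b d), (c *: r); split; first exact: NZ.
    rewrite scalerDr scaler_sumr; congr (_ + _).
    by apply: eq_bigr => d _; rewrite scalerA.
have WF g m : reducer i D g m -> W ('X_[m] * F g).
  move=> /(reducer_in_s ai) [c ca [cm cg]]; exists (fun d => (d == c)%:R), 0.
  split=> //; rewrite (bigD1 c) ?ca //= eqxx scale1r cm cg big1 ?addr0 //.
  by move=> d /andP[_ /negbTE->]; rewrite scale0r.
have WN b : ~~ J b -> mdeg b = D -> W 'X_[b].
  move=> bJ _; exists (fun=> 0), 'X_[b]; split; first exact: in_span_N_X.
  by rewrite big1 ?add0r // => c _; rewrite scale0r.
have step m : ~~ J m \/ m \in P /\ nonmult m i -> mdeg m = mdeg (val a) ->
    W 'X_[U_(i) + m].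
  move=> hm md; have UmD : mdeg (U_(i) + m) = D by rewrite mdegD mdeg1 md.
  have [mJ|/WN/(_ UmD)//] := boolP (J (U_(i) + m)%MM).
  have [g gP gm] := pommaret_cone hP mJ; have [gle _] := in_coneP _ _ gm.
  pose g' : P := [` gP]%fset.
  have red : reducer i D g' (U_(i) + m - g).
    by apply: cone_reducer => // j ij; apply: (prolong_low hP hm gP gm ij).
  have [lo _ degD] := red.
  rewrite -(submK gle); apply: (rewrite_step hF (g := g')) => // [|c cJ cg].
    exact: WF.
  by apply: (@rewrite_low F hF i D) => //; rewrite cg.
apply: (@submodule_mulX _ _ W) => // b Fb.
have [/eqP e|ne] := boolP (b == val a).
  by rewrite e; apply: step => //; right; split=> //; apply: valP.
have /(marked_tail hF)[bJ bd] : (F a - 'X_[val a])@_b != 0.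
  by rewrite mcoeffB mcoeffX [_ == b]eq_sym (negbTE ne) subr0.
by apply: step => //; left.
Qed.

Lemma marked_basis_syzygous (F : {ffun P -> RA}) M : marked_basis J F M ->
  exists b, syzygous b F.
Proof.
move=> [hF MF [_ MN]].
have [_ _ MM] := family_span_ideal F.
have [_ MD _] := ideal_submodule (family_span_ideal F).
have /choice[b hb] (ia : 'I_n.+1 * P) : exists b : Bidx P -> A,
    nonmult (val ia.2) ia.1 ->
    'X_ia.1 * F ia.2 = \sum_g rel_coef b ia.1 ia.2 g * F g.
  case: ia => i a /=; have [ai|_] := boolP (nonmult _ _); last by exists (fun=> 0).
  have [b [r [rN e]]] := prolong_rewrite hF ai; exists b => _.
  rewrite e rel_coefE [r]MN ?addr0 //; apply/MF/ideal_of_familyE.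
  have -> : r = 'X_i * F a + -1 * (\sum_g rel_coef b i a g * F g).
    by rewrite rel_coefE e; ring.
  apply: MD; first exact/MM/family_span_mem.
  by apply: MM; exists (rel_coef b i a).
exists (fun c => b (val c).1 c) => i a ai; rewrite (hb (i, a)) //.
apply: eq_bigr => g _; congr (_ * _); apply: eq_bigr => c /andP[/eqP-> _].
by [].
Qed.

(** The linear system is a statement about the syzygy module alone: this is how
    two families with the same syzygies come to share the same matrices. *)
Lemma syzygous_syz b (F : {ffun P -> RA}) : syzygous b F <->
  forall i a, nonmult (val a) i ->
    syz F [ffun g => (g == a)%:R * 'X_i - rel_coef b i a g].
Proof.
have e i a : \sum_g [ffun g => (g == a)%:R * 'X_i - rel_coef b i a g] g * F g
    = 'X_i * F a - \sum_g rel_coef b i a g * F g.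
  rewrite (eq_bigr (fun g => (g == a)%:R * 'X_i * F g - rel_coef b i a g * F g)).
    rewrite sumrB (bigD1 a) //= eqxx mul1r big1 ?addr0 //.
    by move=> g /negbTE->; rewrite !mul0r.
  by move=> g _; rewrite ffunE mulrBl.
split=> h i a ai; first by rewrite /syz e h ?subrr.
by apply/subr0_eq; rewrite -e; apply: h.
Qed.

End OverRing.
End Marked.

(** * Marked bases recovered from their syzygies *)

Section Reconstruction.
Variables (n : nat) (J : pred 'X_{1..n.+1}) (P : {fset 'X_{1..n.+1}}).
Hypothesis hP : is_pommaret_basis J P.
Variables (l1 l : 'I_n.+1) (a0 : P) (d e : nat).
Hypothesis ln : l = n :> nat.
Hypothesis l1n : l1.+1 = n.
Hypothesis J0 : ~~ J 0%MM.
Hypothesis a0E : val a0 = (U_(l) *+ d)%MM.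
Hypothesis Jl1 : J (U_(l1) *+ e)%MM.

Local Notation term := 'X_{1..n.+1}.

Definition lowclass : {pred P} := fun a => (tmin (val a) < l1)%N.
Definition midclass : {pred P} := fun a => tmin (val a) == l1.

Let l1l : (l1 < l)%N. Proof. by move: ln l1n; lia. Qed.

Lemma ord_cases (j : 'I_n.+1) : [\/ (j < l1)%N, j = l1 | j = l].
Proof.
case: (ltngtP j l1) => [h|h|/val_inj h]; [exact: Or31| |exact: Or32].
apply: Or33; apply: val_inj => /=; have := ltn_ord j; lia.
Qed.

Lemma a0_nonmult j : ~~ nonmult (val a0) j.
Proof.
apply/nonmultP => -[k kj]; rewrite a0E mulmnE mnm1E; case: (l =P k) => // e'.
by subst k; have := ltn_ord j; lia.
Qed.

Lemma J_top (m : term) : (d <= m l)%N -> J m.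
Proof.
move=> dm; apply: (pommaret_dvd hP (valP a0)); apply/mnm_lepP => j.
by rewrite a0E mulmnE mnm1E; case: eqP => [<-|_]; rewrite ?mul1n ?mul0n.
Qed.

Lemma a0_uniq (a : P) : ~~ nonmult (val a) l -> a = a0.
Proof.
move=> al; apply: val_inj.
have cl j : j != l -> val a j = 0%N.
  move=> jl; apply: (nonmult_free al); rewrite -val_eqE /= in jl.
  by have := ltn_ord j; lia.
have cone0 (m : term) : (d <= m l)%N -> in_cone (val a0) m.
  move=> dm; apply/in_coneP; split; last by move=> i; rewrite (negbTE (a0_nonmult i)).
  apply/mnm_lepP => j; rewrite a0E mulmnE mnm1E.
  by case: eqP => [<-|_]; rewrite ?mul1n ?mul0n.
have conea (m : term) : (val a l <= m l)%N -> in_cone (val a) m.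
  move=> am; apply/in_coneP; split.
    by apply/mnm_lepP => j; have [->//|/cl->] := eqVneq j l.
  move=> i /nonmultP[j ji]; have [ejl|/cl->//] := eqVneq j l.
  by move: ji; rewrite ejl ltnNge ln -ltnS ltn_ord.
have [h|h] := leqP d (val a l).
  by apply: (pommaret_uniq hP (valP a) (valP a0) (in_cone_refl _)); apply: cone0.
apply: (pommaret_uniq hP (valP a) (valP a0) _ (in_cone_refl _)).
by apply: conea; rewrite a0E mulmnE mnm1E eqxx mul1n ltnW.
Qed.

Lemma classesE a : (a \in lowclass) = ~~ ((a \in midclass) || (a == a0)).
Proof.
rewrite !unfold_in /lowclass /midclass.
have [-> |aa0] := eqVneq a a0.
  rewrite orbT; apply/negbTE; have := a0_nonmult l; rewrite /nonmult -!leqNgt.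
  by apply: leq_trans; apply: ltnW.
have : nonmult (val a) l by apply: contraNT aa0 => /a0_uniq->.
rewrite /nonmult orbF; lia.
Qed.

Lemma a0_mid : a0 \notin midclass.
Proof.
rewrite unfold_in /midclass; have := a0_nonmult l; rewrite /nonmult; lia.
Qed.

(** The exponents of x_l separate the middle class: two of its elements with the
    same exponent differ by a power of x_l1, which is multiplicative. *)
Lemma card_midclass : (#|midclass| <= d)%N.
Proof.
have mid_low (a : P) (j : 'I_n.+1) : a \in midclass -> (j < l1)%N -> val a j = 0%N.
  rewrite unfold_in => /eqP ta; apply: nonmult_free.
  by rewrite /nonmult ta ltnn.
have cone (a a' : P) : a \in midclass -> a' \in midclass -> val a l = val a' l ->
    (val a l1 <= val a' l1)%N -> a = a'.
  move=> aU a'U el el1; apply/esym/val_inj.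
  apply: (pommaret_uniq hP (valP a') (valP a) (in_cone_refl _)).
  apply/in_coneP; split.
    apply/mnm_lepP => j; have [jl|->|->] := ord_cases j; rewrite ?el //.
    by rewrite mid_low.
  move=> i; have [il|->|->//] := ord_cases i; rewrite /nonmult (eqP aU); lia.
have inj : {in midclass &, injective (fun a : P => val a l)}.
  move=> a a' aU a'U el; have [h|/ltnW h] := leqP (val a l1) (val a' l1).
    exact: cone.
  by apply/esym; apply: cone.
rewrite cardE -(size_map (fun a : P => val a l)) -(size_iota 0 d).
apply: uniq_leq_size => [|k /mapP[a]].
  rewrite map_inj_in_uniq ?enum_uniq // => a a'; rewrite !mem_enum.
  exact: inj.
rewrite mem_enum => aU ->; rewrite mem_iota add0n /= ltnNge.
apply/negP => dal; suff ea : a = a0 by have := a0_mid; rewrite -ea aU.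
apply: val_inj; apply: (pommaret_uniq hP (valP a) (valP a0) (in_cone_refl _)).
apply/in_coneP; split; last by move=> i; rewrite (negbTE (a0_nonmult i)).
apply/mnm_lepP => j; rewrite a0E mulmnE mnm1E.
by case: eqP => [<-|_]; rewrite ?mul1n ?mul0n.
Qed.

Section OverRing.
Variable A : comNzRingType.
Local Notation RA := {mpoly A[n.+1]}.
Implicit Types F : {ffun P -> RA}.

Lemma marked_monic F : marked_set J F -> xmonic l d (F a0).
Proof.
move=> hF m dm; have [_ _ FN] := hF a0; apply/eqP; apply: contraT => Fm.
have := FN m; rewrite mcoeff_msupp a0E -mpolyXn => /(_ Fm).
by rewrite J_top.
Qed.

(** The quotient by (F) is spanned over the polynomials in the variables below
    x_l1 by the d * e terms t = x_l^u x_l1^v; the characteristic determinant of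
    multiplication by x_l1 on them annihilates t = 1 modulo (F). *)
Lemma marked_resultant F : marked_set J F -> exists k (c : P -> RA),
  xmonic l1 k (\sum_g c g * F g) /\ \sum_g c g * F g \in @lowvars n.+1 A l.
Proof.
move=> hF; have [M0 MD MM] := family_span_ideal F.
have [_ _ MZ] := ideal_submodule (family_span_ideal F).
have e0 : (0 < e)%N by case: (e) Jl1 J0 => // ->.
have d0 : (0 < d)%N.
  by rewrite lt0n; apply: contraNneq J0 => d0; apply: J_top; rewrite d0.
pose I := ('I_d * 'I_e)%type.
pose t (s : I) : RA := 'X_l ^+ s.1 * 'X_l1 ^+ s.2.
pose W p := exists (H : I -> RA) q, [/\ forall s, H s \in @lowvars n.+1 A l1,
  family_span F q & p = \sum_s H s * t s + q].
have hW : is_submodule W.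
  split=> [|_ _ [H [q [hH hq ->]]] [H' [q' [hH' hq' ->]]]|c _ [H [q [hH hq ->]]]].
  - exists (fun=> 0), 0; split=> // [s|]; first exact: rpred0.
    by rewrite big1 ?addr0 // => s _; rewrite mul0r.
  - exists (fun s => H s + H' s), (q + q'); split=> [s||]; first exact: rpredD.
      exact: MD.
    rewrite addrACA -big_split; congr (_ + _).
    by apply: eq_bigr => s _; rewrite mulrDl.
  - exists (fun s => c *: H s), (c *: q); split=> [s||]; first exact: lowvarsZ.
      exact: MZ.
    rewrite scalerDr scaler_sumr; congr (_ + _).
    by apply: eq_bigr => s _; rewrite scalerAl.
have WN m : ~~ J m -> W 'X_[m].
  move=> mJ; have [ml|/J_top] := ltnP (m l) d; last by rewrite (negbTE mJ).
  have me : (m l1 < e)%N.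
    rewrite ltnNge; apply: contra mJ => em; apply: (terms_up hP) Jl1 _.
    apply/mnm_lepP => j; rewrite mulmnE mnm1E.
    by case: eqP => [<-|_]; rewrite ?mul1n ?mul0n.
  pose s0 : I := (Ordinal ml, Ordinal me).
  pose m' : term := [multinom if (j < l1)%N then m j else 0%N | j < n.+1].
  exists (fun s => (s == s0)%:R * 'X_[m']), 0; split=> // [s|].
    rewrite rpredM ?rpred_nat //; apply: lowvarsX => j lj.
    by rewrite mnmE ltnNge lj.
  rewrite addr0 (bigD1 s0) //= eqxx mul1r big1 ?addr0 => [|s /negbTE->]; last first.
    by rewrite !mul0r.
  rewrite /t /= !mpolyXn -!mpolyXD; congr 'X_[_]; apply/mnmP => j.
  rewrite !mnmDE mnmE !mulmnE !mnm1E; have [jl|->|->] := ord_cases j.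
  - rewrite jl; case: eqP => [?|_]; first by subst j; lia.
    by case: eqP => [?|_]; [subst j; lia | rewrite !mul0n !addn0].
  - rewrite ltnn eqxx mul1n; case: eqP => [?|_]; last by [].
    by have := l1l; subst l; rewrite ltnn.
  - rewrite ltnNge (ltnW l1l) eqxx mul1n; case: eqP => [?|_]; last by rewrite addn0.
    by have := l1l; rewrite -(_ : l1 = l) ?ltnn //; apply/val_inj; congr val.
have Wall p : W p.
  have [q [r [hq hr ->]]] := marked_generates hP hF p J0; have [_ WD _] := hW.
  apply: WD.
    exists (fun=> 0), q; split=> // [s|]; first exact: rpred0.
    by rewrite big1 ?add0r // => s _; rewrite mul0r.
  apply: (submodule_full (W := W)) => // m; rewrite -mcoeff_msupp => /hr.
  exact: WN.
have /choice[H /choice[q Hq]] : forall s, exists H q,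
    [/\ forall s', H s' \in @lowvars n.+1 A l1,
      family_span F q & 'X_l1 * t s = \sum_s' H s' * t s' + q].
  by move=> s; apply: Wall.
pose D := \det (sys_mx predT 'X_l1 H).
have HL s s' : H s s' \in @lowvars n.+1 A l1 by case: (Hq s).
have DM : family_span F D.
  pose s0 : I := (Ordinal d0, Ordinal e0).
  have -> : D = D * t s0 by rewrite /t !expr0 !mulr1.
  rewrite (@cramer _ _ predT 'X_l1 H t q) => [|s _|//]; last by case: (Hq s).
  by elim/big_ind: _ => // s _; apply: MM; case: (Hq s).
have [c Dc] := DM; exists #|(predT : {pred I})|, c; rewrite -Dc; split.
  by apply: det_xmonic => r s; rewrite mxE.
apply: sys_det_in => [|s s']; last by apply: lowvarsW (HL s s'); apply: ltnW.
by apply: lowvarsX => j lj; rewrite mnm1E; case: eqP lj l1l => // ->; case: ltngtP.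
Qed.

Lemma marked_eliminable F b : marked_set J F -> syzygous b F ->
  eliminable l1 l lowclass a0 d (rel_coef b l1) (rel_coef b l) F.
Proof.
move=> hF hb; split=> [a aa0|a aT||].
- by apply: hb; apply: contraNT aa0 => /a0_uniq->.
- exact: hb.
- exact: marked_monic.
- exact: marked_resultant.
Qed.

Lemma marked_over (S : subringClosed A) F b : marked_set J F -> syzygous b F ->
  (forall c, b c \in S) -> forall a, F a \is a mpolyOver n.+1 S.
Proof.
move=> hF hb bS.
apply: (elim_over l1l classesE a0_mid card_midclass
  (rel_coef_low b l1) (rel_coef_low b l) (marked_eliminable hF hb));
  by move=> a g; apply: rel_coef_over.
Qed.

Lemma marked_uniq F F' b : marked_set J F -> marked_set J F' ->
  syzygous b F -> syzygous b F' -> F = F'.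
Proof.
move=> hF hF' hb hb'; apply/ffunP.
exact: (elim_uniq l1l classesE a0_mid card_midclass
  (rel_coef_low b l1) (rel_coef_low b l)
  (marked_eliminable hF hb) (marked_eliminable hF' hb')).
Qed.

End OverRing.
End Reconstruction.

(** * Depth at least two *)

Section Depth.
Variable n : nat.
Local Notation term := 'X_{1..n.+1}.

(** Multiply m by a power of x_i exceeding all exponents in P: the basis element
    whose cone contains the product must have x_i multiplicative, hence involve
    neither smaller variables nor, by divisibility, larger ones. *)
Lemma pommaret_pure (J : pred term) (P : {fset term}) (i : 'I_n.+1) (m : term) :
    is_pommaret_basis J P -> J m -> (forall j : 'I_n.+1, (i < j)%N -> m j = 0%N) ->
  exists2 a, a \in P & a = (U_(i) *+ a i)%MM.
Proof.
move=> hP Jm m0; pose B := \max_(a : P) mdeg (val a).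
have [] := pommaret_cone hP (terms_up hP Jm (lem_addr m (U_(i) *+ B.+1))).
move=> a aP /in_coneP[ale ah]; exists a => //.
have ai : ~~ nonmult a i.
  apply/negP => /ah; rewrite mnmDE mulmnE mnm1E eqxx mul1n => e.
  have : (mdeg (val [` aP]%fset) <= B)%N by rewrite /B (bigD1 [` aP]%fset) //= leq_maxl.
  by rewrite mdegE (bigD1 i) //= -e; lia.
apply/mnmP => j; rewrite mulmnE mnm1E; case: (ltngtP i j) => ij.
- have := mnm_lepP ale j; rewrite mnmDE m0 // mulmnE mnm1E.
  by case: eqP ij => [->|_ _]; rewrite ?ltnn // !mul0n leqn0 => /eqP.
- rewrite (nonmult_free ai ij); case: eqP ij => [->|_ _]; first by rewrite ltnn.
  by rewrite mul0n.
- by rewrite (val_inj ij) eqxx mul1n.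
Qed.

Variable K : fieldType.
Local Notation R := {mpoly K[n.+1]}.
Implicit Types (J : ideal R) (p q : R).

Lemma ideal_gen_nil (A : comNzRingType) (x : A) :
  ideal_gen (fun y => y \in ([::] : seq A)) x -> x = 0.
Proof. by move=> [[|k] [c [g [hg ->]]]]; [rewrite big_ord0 | case: (hg ord0)]. Qed.

Lemma ideal_gen_seq1 (A : comNzRingType) (f x : A) :
  ideal_gen (fun y => y \in [:: f]) x <-> exists c, x = c * f.
Proof.
split=> [[k [c [g [hg ->]]]]|[c ->]].
  exists (\sum_i c i); rewrite mulr_suml; apply: eq_bigr => i _.
  by have := hg i; rewrite inE => /eqP ->.
exists 1%N, (fun=> c), (fun=> f); split=> [i|]; first exact: mem_head.
by rewrite big_ord1.
Qed.

Lemma monomial_ideal_supp J p m : monomial_ideal J -> J p -> p@_m != 0 -> terms J m.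
Proof.
move=> [T hT] /hT [k [c [g [hg ->]]]] pm; apply/asboolP.
have [i im] : exists i, (c i * g i)@_m != 0.
  apply: contrapT => h; case/eqP: pm; rewrite raddf_sum big1 // => i _.
  by apply/eqP; apply: contrapT => /negP im; apply: h; exists i.
have [t Tt gt] := hg i.
have Jt : J 'X_[t].
  by apply/hT; exists 1%N, (fun=> 1), (fun=> 'X_[t]); rewrite big_ord1 scale1r;
     split=> // _; exists t.
suff tm : (t <= m)%MM.
  by rewrite -(submK tm) mpolyXD; have [_ _ JM] := idealP J; apply: JM.
move: im; rewrite gt; have := msuppMX (c i) t => /perm_mem h.
by rewrite -mcoeff_msupp h => /mapP[k' _ ->]; apply: lem_addr.
Qed.

Lemma divX (i : 'I_n.+1) p : (forall m, p@_m != 0 -> m i != 0%N) ->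
  exists q, p = 'X_i * q.
Proof.
move=> h; exists (\sum_(m <- msupp p) p@_m *: 'X_[m - U_(i)]).
rewrite {1}[p]mpolyE mulr_sumr big_seq [RHS]big_seq; apply: eq_bigr => m.
rewrite mcoeff_msupp => /h mi; rewrite -scalerAr -mpolyXD addmC submK //.
by rewrite lep1mP.
Qed.

(** Two elements x_i f' and x_i g' never form a regular sequence, since
    (x_i g') f' = g' (x_i f') would put f' in (x_i f'), which is absurd unless f' = 0. *)
Lemma depth_not_in_X J d (i : 'I_n.+1) : is_depth J d -> (2 <= d)%N ->
  ~ (forall p, J p -> exists q, p = 'X_i * q).
Proof.
move=> [[s [[reg _] sJ sd]] _] d2 JX; move: d2; rewrite -sd => s2.
have [f [g [s' es]]] : exists f g s', s = [:: f, g & s'].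
  by case: s s2 {reg sJ sd} => [|f [|g s']] // _; exists f, g, s'.
subst s; have f0 : f != 0.
  apply/eqP => f0; have := reg 0%N 1 isT; rewrite f0 /= mulr1.
  have z : ideal_gen (fun y : R => y \in [::]) 0.
    by case: (ideal_genP (fun y : R => y \in [::])).
  by move/(_ z)/ideal_gen_nil/eqP; rewrite oner_eq0.
have [f' ef] := JX f (sJ f (mem_head _ _)).
have [g' eg] := JX g (sJ g (mem_behead (s := [:: f, g & s']) (mem_head g s'))).
have : ideal_gen (fun y => y \in [:: f]) (g * f').
  by apply/ideal_gen_seq1; exists g'; rewrite ef eg; ring.
move/(reg 1%N f' isT)/ideal_gen_seq1 => [c ec].
have : f' * (1 - c * 'X_i) = 0 by rewrite mulrBr mulr1 {1}ec ef; ring.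
move/eqP; rewrite mulf_eq0 => /orP[/eqP f'0|].
  by move: f0; rewrite ef f'0 mulr0 eqxx.
rewrite subr_eq0 => /eqP/(congr1 (mcoeff 0%MM)).
rewrite mcoeff1 eqxx mcoeffM big1 => [/eqP|[k1 k2] /= /eqP/mnmP/(_ i)].
  by rewrite oner_eq0.
rewrite mnm0E mnmDE => /esym/eqP; rewrite addn_eq0 => /andP[_ /eqP k2i].
rewrite mcoeffX; case: eqP => [e|]; last by rewrite mulr0.
by move: k2i; rewrite -e mnm1E eqxx.
Qed.

(** Depth at least 2 prevents J from being contained in the ideal of the largest
    variable, so J has a term free of it; [pommaret_pure] then applies to this
    term with both of the two largest variables. *)
Lemma depth2_pure_powers J (P : {fset term}) d :
    monomial_ideal J -> is_pommaret_basis (terms J) P ->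
    is_depth J d -> (2 <= d)%N -> ~~ terms J 0%MM ->
  exists (l1 l : 'I_n.+1) (a0 : P) (k e : nat),
    [/\ l = n :> nat, l1.+1 = n, val a0 = (U_(l) *+ k)%MM
      & terms J (U_(l1) *+ e)%MM].
Proof.
move=> hJ hP hd d2 J0; pose l : 'I_n.+1 := ord_max.
have [p Jp np] : exists2 p, J p & ~ exists q, p = 'X_l * q.
  by have /existsNP[p /not_implyP[Jp np]] := depth_not_in_X (i := l) hd d2; exists p.
have [m pm ml] : exists2 m, p@_m != 0 & m l = 0%N.
  apply: contrapT => h; case: np; apply: divX => m pm.
  by apply/eqP => ml; apply: h; exists m.
have Jm := monomial_ideal_supp hJ Jp pm.
have [] := pommaret_pure (i := l) hP Jm.
  by move=> j; rewrite ltnNge -ltnS ltn_ord.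
move=> a aP ea.
have n0 : (0 < n)%N.
  rewrite lt0n; apply: contraNneq J0 => n0; suff <- : m = 0%MM by [].
  apply/mnmP => j; rewrite mnm0E -[RHS]ml; congr (m _); apply: val_inj.
  by have := ltn_ord j; rewrite /=; lia.
pose l1 : 'I_n.+1 := inord n.-1.
have l1E : l1 = n.-1 :> nat by rewrite inordK //; lia.
have [] := pommaret_pure (i := l1) hP Jm.
  move=> j; rewrite l1E => jn; rewrite -[RHS]ml; congr (m _); apply: val_inj.
  by have := ltn_ord j; rewrite /=; lia.
move=> b bP eb; exists l1, l, [` aP]%fset, (a l), (b l1); split=> //.
  by rewrite l1E prednK.
by rewrite -eb; apply: (pommaret_mem hP).
Qed.

End Depth.

Section Depth2.
Variables (K : fieldType) (n : nat) (I : ideal {mpoly K[n.+1]}).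
Variables (P : {fset 'X_{1..n.+1}}) (d : nat).
Hypotheses (hI : monomial_ideal I) (hP : is_pommaret_basis (terms I) P).
Hypotheses (hd : is_depth I d) (hd2 : (2 <= d)%N).
Variable A : comNzRingType.
Local Notation J := (terms I).
Implicit Types F : {ffun P -> {mpoly A[n.+1]}}.

Lemma marked_set_unit F a : J 0%MM -> marked_set J F -> F a = 'X_[val a].
Proof.
move=> J0 hF; apply/subr0_eq/mpolyP => m; rewrite mcoeff0; apply/eqP.
apply: contraT => /(marked_tail hF)[/negP[]].
by apply: (terms_up hP J0); apply/mnm_lepP => j; rewrite mnm0E.
Qed.

(** When J is the whole ring there are no normal forms, and F consists of terms. *)
Lemma depth2_over (S : subringClosed A) F b : marked_set J F -> syzygous b F ->
  (forall c, b c \in S) -> forall a, F a \is a mpolyOver n.+1 S.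
Proof.
move=> hF hb bS; have [J0 a|J0] := boolP (J 0%MM).
  by rewrite (marked_set_unit _ J0 hF); apply: mpolyOverX.
have [l1 [l [a0 [k [e [ln l1n a0E Je]]]]]] := depth2_pure_powers hI hP hd hd2 J0.
exact: (marked_over hP ln l1n J0 a0E Je hF hb bS).
Qed.

Lemma depth2_uniq F F' b : marked_set J F -> marked_set J F' ->
  syzygous b F -> syzygous b F' -> F = F'.
Proof.
move=> hF hF' hb hb'; have [J0|J0] := boolP (J 0%MM).
  by apply/ffunP => a; rewrite !marked_set_unit.
have [l1 [l [a0 [k [e [ln l1n a0E Je]]]]]] := depth2_pure_powers hI hP hd hd2 J0.
exact: (marked_uniq hP ln l1n J0 a0E Je hF hF' hb hb').
Qed.

End Depth2.

Section MapMarked.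
Variables (n : nat) (J : pred 'X_{1..n.+1}) (P : {fset 'X_{1..n.+1}}).
Variables (A B : comNzRingType) (phi : {rmorphism A -> B}).

Lemma map_marked_set (F : {ffun P -> {mpoly A[n.+1]}}) : marked_set J F ->
  marked_set J [ffun a => map_mpoly phi (F a)].
Proof.
move=> hF a; have [/dhomogP Fh F1 FN] := hF a; rewrite ffunE.
have supp p m : m \in msupp (map_mpoly phi p) -> m \in msupp p.
  rewrite !mcoeff_msupp mcoeff_map_mpoly; apply: contraNneq => ->.
  by rewrite raddf0.
split; first by apply/dhomogP => m /supp /Fh.
  by rewrite mcoeff_map_mpoly F1; exact: rmorph1.
move=> m; rewrite -(map_mpolyX phi) -raddfB => /supp; exact: FN.
Qed.

End MapMarked.

Section NonzeroQuotient.
Variables (K : fieldType) (R : comAlgType K) (I : ideal R).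

(** The quotient as a nonzero ring, over which polynomials can be formed; the
    proof of nontriviality is an argument of the type so that the ring structure
    can be attached to it. *)
Definition nzquot (_ : ~ I 1) : Type := quotalg I.

Variable hI : ~ I 1.

HB.instance Definition _ := GRing.ComPzRing.on (nzquot hI).

Lemma nzquot_neq0 : (1 : nzquot hI) != 0.
Proof.
apply/eqP => e; apply: hI.
have : qproj I 1 = qproj I 0 by rewrite raddf0.
by move/qprojP; rewrite subr0 => /asboolP.
Qed.

HB.instance Definition _ :=
  GRing.PzSemiRing_isNonZero.Build (nzquot hI) nzquot_neq0.

Definition nzproj (x : R) : nzquot hI := qproj I x.

Lemma nzproj_zmod : zmod_morphism nzproj.
Proof. exact: qproj_is_zmod_morphism. Qed.

Lemma nzproj_monoid : monoid_morphism nzproj.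
Proof. by split=> // x y; apply: qprojM. Qed.

HB.instance Definition _ :=
  GRing.isZmodMorphism.Build R (nzquot hI) nzproj nzproj_zmod.
HB.instance Definition _ :=
  GRing.isMonoidMorphism.Build R (nzquot hI) nzproj nzproj_monoid.


End NonzeroQuotient.

(** * The generic marked set and its parameters *)

Section RingImage.
Variables (R S : comNzRingType) (f : {rmorphism R -> S}).

Definition ring_image : {pred S} := fun x => `[< exists q, x = f q >].

Lemma ring_image_zmod : zmod_closed ring_image.
Proof.
split=> [|_ _ /asboolP[q ->] /asboolP[r ->]]; apply/asboolP.
  by exists 0; rewrite rmorph0.
by exists (q - r); rewrite rmorphB.
Qed.

Lemma ring_image_mul : mulr_closed ring_image.
Proof.
split=> [|_ _ /asboolP[q ->] /asboolP[r ->]]; apply/asboolP.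
  by exists 1; rewrite rmorph1.
by exists (q * r); rewrite rmorphM.
Qed.

HB.instance Definition _ := GRing.isZmodClosed.Build S ring_image ring_image_zmod.
HB.instance Definition _ := GRing.isMulClosed.Build S ring_image ring_image_mul.

End RingImage.

Section Generic.
Variables (K : fieldType) (n : nat) (J : pred 'X_{1..n.+1}).
Variables (P : {fset 'X_{1..n.+1}}).
Hypothesis hP : is_pommaret_basis J P.

Lemma coef_genF (c : Cidx J P) :
  (genF J K (val c).1)@_(bmnm (val c).2) = - Cvar K c.
Proof.
have /andP[cJ _] := valP c.
rewrite mcoeffB mcoeffX; case: eqP => [e|_].
  by move: cJ; rewrite -e (pommaret_mem hP (valP _)).
rewrite sub0r; congr (- _); rewrite raddf_sum (bigD1 c) //= mcoeffZ mcoeffX eqxx.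
rewrite mulr1 big1 ?addr0 // => c' /andP[/eqP e1 ne].
rewrite mcoeffZ mcoeffX; case: eqP => [/val_inj e2|]; last by rewrite mulr0.
case/eqP: ne; apply: val_inj.
by rewrite [LHS]surjective_pairing [RHS]surjective_pairing e1 e2.
Qed.

Lemma genF_marked : marked_set J [ffun a : P => genF J K a].
Proof.
move=> a; rewrite ffunE.
have tailE : genF J K a - 'X_[val a] =
    - \sum_(c : Cidx J P | (val c).1 == a) Cvar K c *: 'X_[bmnm (val c).2].
  by rewrite /genF addrAC subrr add0r.
have coef0 m : J m -> (genF J K a - 'X_[val a])@_m = 0.
  move=> Jm; rewrite tailE mcoeffN raddf_sum big1 ?oppr0 //= => c _.
  rewrite mcoeffZ mcoeffX; case: eqP => [e|]; last by rewrite mulr0.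
  by have /andP[] := valP c; rewrite e Jm.
split.
- rewrite rpredB ?dhomogX //; apply: rpred_sum => c /eqP ca.
  have /andP[_ /eqP cd] := valP c.
  by apply: dhomogZ; rewrite dhomogX -ca; apply/eqP.
- have := coef0 _ (pommaret_mem hP (valP a)).
  by rewrite mcoeffB mcoeffX eqxx => /subr0_eq.
- by move=> m; rewrite mcoeff_msupp; apply: contraNN => /coef0 ->.
Qed.

End Generic.

Section ParameterElimination.
Variables (K : fieldType) (n : nat) (I : ideal {mpoly K[n.+1]}).
Variables (P : {fset 'X_{1..n.+1}}) (d : nat).
Hypotheses (hI : monomial_ideal I) (hP : is_pommaret_basis (terms I) P).
Hypotheses (hd : is_depth I d) (hd2 : (2 <= d)%N).
Local Notation J := (terms I).
Local Notation KB := {mpoly K[#|{: Bidx P}|]}.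
Local Notation KBC := {mpoly K[#|{: Bidx P + Cidx J P}|]}.
Local Notation S := (scrS J P K).
Local Notation proj := (qproj S).

Lemma inclB_pvar (x : Bidx P) : inclB J P K (pvar K x) = Bvar J K x.
Proof. by rewrite /inclB /pvar comp_mpolyXU -tnth_nth tnth_mktuple enum_rankK. Qed.

(** Over the quotient by the syzygy equations the generic marked set satisfies
    the linear system whose coefficients are the classes of the B, so its own
    coefficients, which are the classes of the -C, lie in the image of K[B]. *)
Lemma parameter_elim (c : Cidx J P) :
  exists q : KB, proj (Cvar K c) = proj (inclB J P K q).
Proof.
have [S1|hS] := pselect (S 1).
  exists 0; apply/qprojP/asboolP; have [_ _ SM] := idealP S.
  by rewrite -[_ - _]mulr1; apply: SM.
pose phi : {rmorphism KBC -> nzquot hS} := nzproj hS.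
pose F := [ffun a : P => map_mpoly phi ([ffun a : P => genF J K a] a)].
have hF : marked_set J F by exact: map_marked_set (genF_marked K hP).
pose b (x : Bidx P) := phi (Bvar J K x).
have hb : syzygous b F.
  move=> i a ai; rewrite rel_coefE; apply/subr0_eq.
  transitivity (map_mpoly phi (gen_syz J K i a)); last first.
    apply/mpolyP => m; rewrite mcoeff_map_mpoly mcoeff0.
    rewrite -[RHS](raddf0 phi); apply/qprojP/asboolP; rewrite subr0.
    exists 1%N, (fun=> 1), (fun=> (gen_syz J K i a)@_m).
    by rewrite big_ord1 scale1r; split=> // _; exists i, a, m.
  rewrite /gen_syz rmorphB rmorphM /= map_mpolyX !ffunE; congr (_ - _).
  rewrite [RHS]raddf_sum /=.
  by apply: eq_bigr => x _; rewrite map_mpolyZ rmorphM /= map_mpolyX !ffunE.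
pose psi : {rmorphism KB -> nzquot hS} := phi \o inclB J P K.
have bS x : b x \in ring_image psi.
  by apply/asboolP; exists (pvar K x); rewrite /= inclB_pvar.
have /mpolyOverP/(_ (bmnm (val c).2)) := depth2_over hI hP hd hd2 hF hb bS (val c).1.
rewrite !ffunE mcoeff_map_mpoly coef_genF // => /asboolP[q eq].
by exists (- q); rewrite rmorphN [RHS]raddfN -[RHS]/(- psi q) -eq raddfN opprK.
Qed.

Lemma inclB_surj (p : KBC) : exists q : KB, proj p = proj (inclB J P K q).
Proof.
pose W (p : KBC) := exists q : KB, proj p = proj (inclB J P K q).
have WM p1 p2 : W p1 -> W p2 -> W (p1 * p2).
  move=> [q1 e1] [q2 e2]; exists (q1 * q2).
  by rewrite (qprojM S p1) e1 e2 -qprojM -rmorphM.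
have WC c : W c%:MP.
  by exists c%:MP; rewrite /inclB comp_mpolyC.
have WX i : W 'X_i.
  rewrite -[i]enum_valK; case: (enum_val i) => [x|x].
    by exists (pvar K x); rewrite inclB_pvar.
  exact: parameter_elim.
apply: (submodule_full (W := W)) => [|m _].
  split=> [|p1 p2 [q1 e1] [q2 e2]|c p1].
  - by exists 0; rewrite rmorph0.
  - by exists (q1 + q2); rewrite rmorphD !raddfD /= e1 e2.
  - by rewrite -mul_mpolyC; apply: WM.
rewrite mpolyXE_id; elim/big_ind: _ => //; first exact: (WC 1).
by move=> i _; elim: (m i) => [|k IH]; [exact: (WC 1)|rewrite exprS; apply: WM].
Qed.

Lemma param_quot_iso : quotalg_iso S (scrS_B J P K).
Proof.
have /choice[s hs] := inclB_surj.
have inclP (q q' : KB) : proj (inclB J P K q) = proj (inclB J P K q') <->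
    qproj (scrS_B J P K) q = qproj (scrS_B J P K) q'.
  split=> /qprojP/asboolP h; apply/qprojP/asboolP.
    by rewrite /= rmorphB.
  by move: h; rewrite /= rmorphB.
pose f (x : quotalg S) : quotalg (scrS_B J P K) := qproj _ (s (qrepr x)).
have fE q : f (proj (inclB J P K q)) = qproj _ q.
  by apply/inclP; rewrite -hs qreprK.
have surj x : exists q, x = proj (inclB J P K q).
  by exists (s (qrepr x)); rewrite -hs qreprK.
have pM (L : comAlgType K) (M : ideal L) x y :
  qproj M (x * y) = qproj M x * qproj M y by exact: qprojM.
have fB : zmod_morphism f.
  move=> x y; have [q ->] := surj x; have [r ->] := surj y.
  by rewrite -raddfB -rmorphB !fE raddfB.
have fM : monoid_morphism f.
  split=> [|x y]; first by rewrite -[1]/(proj 1) -(rmorph1 (inclB J P K)) fE.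
  have [q ->] := surj x; have [r ->] := surj y.
  by rewrite -pM -rmorphM !fE pM.
pose fa := GRing.isZmodMorphism.Build _ _ f fB.
pose fm := GRing.isMonoidMorphism.Build _ _ f fM.
pose g : {rmorphism quotalg S -> quotalg (scrS_B J P K)} := HB.pack f fa fm.
exists g; split.
  exists (fun y => proj (inclB J P K (qrepr y))) => [x|y] /=.
    have [q ->] := surj x; rewrite fE; apply/inclP; exact: qreprK.
  by rewrite fE qreprK.
move=> a x /=; have [q ->] := surj x.
rewrite -[a *: _]/(qscale _ _) -qprojZ.
have <- : inclB J P K (a *: q) = a *: inclB J P K q by rewrite /inclB linearZ.
by rewrite !fE qprojZ.
Qed.

End ParameterElimination.

(** * Base change of marked bases and of their syzygies *)

Section RSpan.
Variables (R : nzRingType) (V : lmodType R) (G : V -> Prop).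

Lemma rspan_submodule : is_submodule (rspan G).
Proof.
split=> [|_ _ [k [c [g [Gg ->]]]] [l [d [h [Gh ->]]]]|a _ [k [c [g [Gg ->]]]]].
- by exists 0%N, (fun=> 0), (fun=> 0); rewrite big_ord0; split=> // -[].
- exists (k + l)%N.
  exists (fun i => match split i with inl j => c j | inr j => d j end).
  exists (fun i => match split i with inl j => g j | inr j => h j end).
  split=> [i|]; first by case: (split i).
  rewrite big_split_ord /=; congr (_ + _); apply: eq_bigr => i _.
    by rewrite -[lshift _ _]/(unsplit (inl i)) unsplitK.
  by rewrite -[rshift _ _]/(unsplit (inr i)) unsplitK.
- exists k, (fun i => a * c i), g; split=> //.
  by rewrite scaler_sumr; apply: eq_bigr => i _; rewrite scalerA.
Qed.

Lemma rspan_gen v : G v -> rspan G v.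
Proof.
by move=> Gv; exists 1%N, (fun=> 1), (fun=> v); rewrite big_ord1 scale1r.
Qed.

Lemma rspan_min (W : V -> Prop) : is_submodule W -> (forall v, G v -> W v) ->
  forall v, rspan G v -> W v.
Proof.
move=> [W0 WD WZ] h _ [k [c [g [Gg ->]]]].
by elim/big_ind: _ => // i _; apply/WZ/h.
Qed.

End RSpan.

Lemma ideal_is_submodule (R : comNzRingType) (M : R -> Prop) :
  is_ideal M <-> @is_submodule R R^o M.
Proof. by split=> -[]. Qed.

Section LinearExtension.
Variables (n : nat) (A : comNzRingType) (V : lmodType A) (h : 'X_{1..n} -> V).
Implicit Types p q : {mpoly A[n]}.

(** The linear map prescribed on monomials; the normal form and the sections of
    the next lemmas are moved along a change of rings by prescribing the images of
    their values. *)
Definition lin_ext p : V := \sum_(m <- msupp p) p@_m *: h m.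

Lemma lin_ext_widen p (s : seq 'X_{1..n}) : uniq s -> {subset msupp p <= s} ->
  lin_ext p = \sum_(m <- s) p@_m *: h m.
Proof.
move=> us ps; rewrite (bigID (mem (msupp p))) /= [X in _ + X]big1 ?addr0.
  rewrite -big_filter; apply: perm_big; apply: uniq_perm.
  - exact: msupp_uniq.
  - exact: filter_uniq.
  by move=> m; rewrite mem_filter /=; case mp: (m \in msupp p); rewrite //= ps.
by move=> m mp; rewrite (memN_msupp_eq0 mp) scale0r.
Qed.

Lemma lin_ext_linear c p q : lin_ext (c *: p + q) = c *: lin_ext p + lin_ext q.
Proof.
pose s := undup (msupp p ++ msupp q ++ msupp (c *: p + q)).
have us : uniq s by exact: undup_uniq.
rewrite !(@lin_ext_widen _ s) //;
  try by move=> m mp; rewrite mem_undup !mem_cat mp ?orbT.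
rewrite scaler_sumr -big_split; apply: eq_bigr => m _ /=.
by rewrite mcoeffD mcoeffZ scalerDl scalerA.
Qed.

Lemma lin_extX m : lin_ext 'X_[m] = h m.
Proof. by rewrite /lin_ext msuppX big_seq1 mcoeffX eqxx scale1r. Qed.

Lemma lin_ext0 : lin_ext 0 = 0.
Proof. by rewrite /lin_ext msupp0 big_nil. Qed.

Lemma lin_extZ c p : lin_ext (c *: p) = c *: lin_ext p.
Proof. by rewrite -[c *: p]addr0 lin_ext_linear lin_ext0 addr0. Qed.

Lemma lin_extD p q : lin_ext (p + q) = lin_ext p + lin_ext q.
Proof. by rewrite -[p in LHS]scale1r lin_ext_linear scale1r. Qed.

End LinearExtension.

Section BaseChange.
Variables (n : nat) (A B : comNzRingType) (phi : {rmorphism A -> B}).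
Local Notation RA := {mpoly A[n]}.
Local Notation RB := {mpoly B[n]}.
Local Notation mphi := (map_mpoly (n := n) phi).

Lemma mapZ c p : mphi (c *: p) = phi c *: mphi p.
Proof. exact: map_mpolyZ. Qed.

Lemma map_lin_ext (h : 'X_{1..n} -> RA) p :
  lin_ext (fun m => mphi (h m)) (mphi p) = mphi (lin_ext h p).
Proof.
apply: (submodule_full (W := fun p =>
  lin_ext (fun m => mphi (h m)) (mphi p) = mphi (lin_ext h p))) => [|m _].
  split=> [|q r eq er|c q eq].
  - by rewrite raddf0 !lin_ext0 raddf0.
  - by rewrite raddfD !lin_extD raddfD eq er.
  - by rewrite mapZ !lin_extZ mapZ eq.
by rewrite map_mpolyX !lin_extX.
Qed.

Lemma map_pihomog d p : pihomog mdeg d (mphi p) = mphi (pihomog mdeg d p).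
Proof.
apply: (submodule_full (W := fun p =>
  pihomog mdeg d (mphi p) = mphi (pihomog mdeg d p))) => [|m _].
  split=> [|q r eq er|c q eq].
  - by rewrite !raddf0.
  - by rewrite !raddfD /= eq er.
  - by rewrite linearZ !mapZ linearZ /= eq.
by rewrite map_mpolyX !pihomogX; case: ifP; rewrite ?map_mpolyX ?raddf0.
Qed.

End BaseChange.

Section ExtIdeal.
Variables (n : nat) (J : pred 'X_{1..n.+1}) (P : {fset 'X_{1..n.+1}}).
Variables (A B : comNzRingType) (phi : {rmorphism A -> B}).
Local Notation RA := {mpoly A[n.+1]}.
Local Notation RB := {mpoly B[n.+1]}.
Local Notation mphi := (map_mpoly (n := n.+1) phi).

Lemma ext_ideal_mem (M : RA -> Prop) p : M p -> ext_ideal phi M (mphi p).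
Proof. by move=> Mp; apply: rspan_gen; exists p. Qed.

(** M is stable under monomials, so its image spans the extended ideal already
    over the coefficient ring B; this makes B-linear maps enough to study it. *)
Lemma ext_ideal_ind (M : RA -> Prop) (W : RB -> Prop) : is_ideal M ->
  is_submodule W -> (forall p, M p -> W (mphi p)) ->
  forall p, ext_ideal phi M p -> W p.
Proof.
move=> [M0 MD MM] [W0 WD WZ] h.
suff hs p : ext_ideal phi M p -> forall m, W ('X_[m] * p).
  by move=> p /hs/(_ 0%MM); rewrite mpolyX0 mul1r.
apply: (@rspan_min RB RB^o _ (fun p => forall m, W ('X_[m] * p)))
  => [|_ [q Mq ->] m]; last by rewrite -(map_mpolyX phi) -rmorphM; apply/h/MM.
split=> [m|q r hq hr m|c q hq m]; first by rewrite mulr0.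
  by rewrite mulrDr; apply: WD.
have -> : 'X_[m] * (c *: q) = \sum_(k <- msupp c) c@_k *: ('X_[m + k] * q).
  rewrite -[c *: q]/(c * q) {1}[c]mpolyE mulr_suml mulr_sumr.
  by apply: eq_bigr => k _; rewrite mpolyXD -scalerAl -scalerAr mulrA.
by elim/big_ind: _ => // k _; apply/WZ/hq.
Qed.

Lemma ext_graded (M : RA -> Prop) : graded_ideal M -> graded_ideal (ext_ideal phi M).
Proof.
move=> [Mi Mh]; split; first exact: ideal_genP.
move=> p d; have [E0 ED EM] : is_ideal (ext_ideal phi M) by exact: ideal_genP.
apply: (ext_ideal_ind (W := fun p => ext_ideal phi M (pihomog mdeg d p)) Mi)
  => [|p' Mp]; last first.
  by rewrite map_pihomog; apply/ext_ideal_mem/Mh.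
split=> [|q r hq hr|c q hq]; first by rewrite raddf0.
  by rewrite raddfD; apply: ED.
by rewrite linearZ /= -mul_mpolyC; apply: EM.
Qed.

Lemma normal_form (M : RA -> Prop) : is_ideal M -> complement_N J M ->
  exists N : 'X_{1..n.+1} -> RA,
    [/\ forall m, in_span_N J (N m), forall m, M ('X_[m] - N m)
      & forall m, ~~ J m -> N m = 'X_[m]].
Proof.
move=> [M0 _ _] [MN _].
have /choice[N hN] m : exists r : RA,
    [/\ in_span_N J r, M ('X_[m] - r) & ~~ J m -> r = 'X_[m]].
  have [mJ|mJ] := boolP (J m); last first.
    by exists 'X_[m]; rewrite subrr; split=> //; apply: in_span_N_X.
  have [q [r [Mq rN e]]] := MN 'X_[m]; exists r; split=> //.
  by rewrite e addrK.
by exists N; split=> m; case: (hN m).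
Qed.

Lemma lin_ext_normal (M : RA -> Prop) (N : 'X_{1..n.+1} -> RA) p :
  is_ideal M -> (forall m, in_span_N J (N m)) -> (forall m, M ('X_[m] - N m)) ->
  in_span_N J (lin_ext N p) /\ M (p - lin_ext N p).
Proof.
move=> Mi NN MN; have [N0 ND NZ] := in_span_N_submodule J A.
have [M0 MD MZ] := ideal_submodule Mi.
apply: (submodule_full (W := fun p => in_span_N J (lin_ext N p)
  /\ M (p - lin_ext N p))) => [|m _]; last by rewrite lin_extX.
split=> [|q r [hq hq'] [hr hr']|c q [hq hq']].
- by rewrite lin_ext0 subrr.
- rewrite lin_extD; split; first exact: ND.
  by rewrite opprD addrACA; apply: MD.
- by rewrite lin_extZ -scalerBr; split; [apply: NZ|apply: MZ].
Qed.

Lemma lin_ext_ideal (M : RA -> Prop) N p : is_ideal M -> complement_N J M ->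
  (forall m, in_span_N J (N m)) -> (forall m, M ('X_[m] - N m)) ->
  M p -> lin_ext N p = 0.
Proof.
move=> Mi [_ MN] NN MNm Mp; have [Nl Ml] := lin_ext_normal p Mi NN MNm.
apply: (MN _ _ Nl); have [_ MD MZ] := ideal_submodule Mi.
rewrite -[lin_ext N p](subKr p) -scaleN1r.
by apply: MD => //; apply: MZ.
Qed.

(** The normal form modulo M, extended linearly to B, kills the extended ideal
    and fixes the normal forms over B, whence the sum stays direct. *)
Lemma ext_complement (M : RA -> Prop) : is_ideal M -> complement_N J M ->
  complement_N J (ext_ideal phi M).
Proof.
move=> Mi Mc; have [N [NN MN NJ]] := normal_form Mi Mc.
have Ei : is_ideal (ext_ideal phi M) by exact: ideal_genP.
have [E0 ED EZ] := ideal_submodule Ei; have [N0 ND NZ] := in_span_N_submodule J B.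
have mapN p : in_span_N J p -> in_span_N J (mphi p).
  move=> pN m; rewrite mcoeff_msupp mcoeff_map_mpoly => pm; apply: pN.
  by rewrite mcoeff_msupp; apply: contraNneq pm => ->; rewrite raddf0.
split=> [p|p Ep pN].
  apply: (submodule_full (W := fun p => exists q r,
    [/\ ext_ideal phi M q, in_span_N J r & p = q + r])) => [|m _].
    split=> [|_ _ [q [r [hq hr ->]]] [q' [r' [hq' hr' ->]]]|c _ [q [r [hq hr ->]]]].
    - by exists 0, 0; rewrite addr0.
    - by exists (q + q'), (r + r'); rewrite addrACA; split; [apply: ED|apply: ND|].
    - by exists (c *: q), (c *: r); rewrite scalerDr; split; [apply: EZ|apply: NZ|].
  exists (mphi ('X_[m] - N m)), (mphi (N m)); split.
  - exact: ext_ideal_mem.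
  - exact: mapN.
  - by rewrite raddfB subrK /= map_mpolyX.
have <- : lin_ext (fun m => mphi (N m)) p = p.
  rewrite [RHS]mpolyE /lin_ext big_seq [RHS]big_seq; apply: eq_bigr => m /pN mJ.
  by rewrite NJ // map_mpolyX.
apply: (ext_ideal_ind (W := fun p => lin_ext (fun m => mphi (N m)) p = 0) Mi _ _ Ep).
  split=> [|q r hq hr|c q hq]; first exact: lin_ext0.
    by rewrite lin_extD hq hr addr0.
  by rewrite lin_extZ hq scaler0.
by move=> q Mq; rewrite map_lin_ext (lin_ext_ideal Mi Mc NN MN Mq) raddf0.
Qed.

Lemma ext_marked_basis (F : {ffun P -> RA}) M : is_ideal M -> marked_basis J F M ->
  marked_basis J [ffun a => mphi (F a)] (ext_ideal phi M).
Proof.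
move=> Mi [hF MF Mc]; split; [exact: map_marked_set| |exact: ext_complement].
have [I0 ID IM] := family_span_ideal [ffun a : P => mphi (F a)].
move=> p; rewrite ideal_of_familyE; split.
  apply: (@rspan_min RB RB^o _ (family_span [ffun a : P => mphi (F a)])).
    exact/ideal_is_submodule/family_span_ideal.
  move=> _ [q /MF/ideal_of_familyE[e ->] ->]; exists (fun g => mphi (e g)).
  by rewrite raddf_sum; apply: eq_bigr => g _; rewrite /= rmorphM ffunE.
have [E0 ED EM] : is_ideal (ext_ideal phi M) by exact: ideal_genP.
move=> [e ->]; elim/big_ind: _ => // g _; apply: EM; rewrite ffunE.
by apply/ext_ideal_mem/MF/ideal_of_familyE/family_span_mem.
Qed.

Lemma syz_submodule (R : comNzRingType) (F : {ffun P -> {mpoly R[n.+1]}}) :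
  is_submodule (syz F).
Proof.
split=> [|g h hg hh|c g hg]; rewrite /syz.
- by rewrite big1 // => a _; rewrite ffunE mul0r.
- transitivity (\sum_a (g a * F a + h a * F a)).
    by apply: eq_bigr => a _; rewrite ffunE mulrDl.
  by rewrite big_split /= [X in X + _]hg hh addr0.
- transitivity (\sum_a c * (g a * F a)).
    by apply: eq_bigr => a _; rewrite ffunE -mulrA.
  by rewrite -mulr_sumr [X in _ * X]hg mulr0.
Qed.

(** The surjection from the free module onto M splits over A, because M has a
    basis given by the x^m - N m with m in J.  Subtracting the section, extended
    linearly to B, projects onto the extended syzygies and is the identity on the
    syzygies of the extended family; so these are spanned by the images of the
    generators, which are images of syzygies over A. *)
Lemma ext_syzE (F : {ffun P -> RA}) M : is_ideal M -> marked_basis J F M ->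
  ext_syz phi (syz F) = syz [ffun a => mphi (F a)].
Proof.
move=> Mi [hF MF Mc]; apply/funext => g; apply/propext; split.
  apply: (rspan_min (W := syz [ffun a => mphi (F a)])); first exact: syz_submodule.
  move=> _ [h hg ->]; rewrite /syz -[RHS](raddf0 (map_mpoly phi)) -hg [RHS]raddf_sum.
  by apply: eq_bigr => a _; rewrite !ffunE; apply/esym/(rmorphM (map_mpoly phi)).
have [N [NN MN _]] := normal_form Mi Mc.
have /choice[s hs] m : exists e : P -> RA, 'X_[m] - N m = \sum_a e a * F a.
  by apply/ideal_of_familyE/MF.
pose sec p a := lin_ext (fun m => s m a) p.
have secE p : M p -> \sum_a sec p a * F a = p.
  move=> Mp; suff -> : \sum_a sec p a * F a = p - lin_ext N p.
    by rewrite (lin_ext_ideal Mi Mc NN MN Mp) subr0.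
  apply: (submodule_full (W := fun p =>
    \sum_a sec p a * F a = p - lin_ext N p)) => [|m _].
    split=> [|q r hq hr|c q hq].
    - by rewrite lin_ext0 subrr big1 // => a _; rewrite /sec lin_ext0 mul0r.
    - rewrite lin_extD opprD addrACA -hq -hr -big_split.
      by apply: eq_bigr => a _; rewrite /sec lin_extD mulrDl.
    - rewrite lin_extZ -scalerBr -hq scaler_sumr.
      by apply: eq_bigr => a _; rewrite /sec lin_extZ scalerAl.
  by rewrite lin_extX hs; apply: eq_bigr => a _; rewrite /sec lin_extX.
pose secB p a := lin_ext (fun m => mphi (s m a)) p.
have [E0 ED EZ] : is_submodule (ext_syz phi (syz F)) := rspan_submodule _.
pose ev (h : {ffun P -> RB^o}) := \sum_a h a * mphi (F a).
(* The projection onto the syzygies along the section. *)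
pose corr (h : {ffun P -> RB^o}) : {ffun P -> RB^o} := h - [ffun a => secB (ev h) a].
have corrD h k : corr (h + k) = corr h + corr k.
  apply/ffunP => a; rewrite !ffunE /secB.
  have -> : ev (h + k) = ev h + ev k.
    by rewrite /ev -big_split; apply: eq_bigr => b _; rewrite ffunE mulrDl.
  by rewrite lin_extD opprD addrACA.
pose dl (a : P) (p : RB) : {ffun P -> RB^o} := [ffun b => (b == a)%:R * p].
have evdl a p : ev (dl a p) = p * mphi (F a).
  rewrite /ev (bigD1 a) //= !ffunE eqxx mul1r big1 ?addr0 // => b /negbTE ba.
  by rewrite ffunE ba !mul0r.
have corr_dl a p : ext_syz phi (syz F) (corr (dl a p)).
  apply: (submodule_full (W := fun p => ext_syz phi (syz F) (corr (dl a p)))) => [|m _].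
    split=> [|q r hq hr|c q hq].
    - suff -> : corr (dl a 0) = 0 by [].
      by apply/ffunP => b; rewrite !ffunE evdl mul0r /secB lin_ext0 mulr0 subr0.
    - have -> : dl a (q + r) = dl a q + dl a r.
        by apply/ffunP => b; rewrite !ffunE mulrDr.
      by rewrite corrD; apply: ED.
    - suff -> : corr (dl a (c *: q)) = c%:MP *: corr (dl a q) by apply: EZ.
      apply/ffunP => b; rewrite !ffunE !evdl /secB -scalerAl lin_extZ.
      by rewrite -scalerAr -[RHS]/(c%:MP * _) mul_mpolyC scalerBr.
  apply: rspan_gen.
  exists [ffun b => (b == a)%:R * 'X_[m] - sec ('X_[m] * F a) b].
    rewrite /syz; under eq_bigr do rewrite ffunE mulrBl; rewrite sumrB secE.
      rewrite (bigD1 a) //= eqxx mul1r big1 ?addr0 ?subrr // => b /negbTE->.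
      by rewrite !mul0r.
    have [_ _ MM] := Mi; apply/MM/MF/ideal_of_familyE.
    exact: family_span_mem.
  apply/ffunP => b; rewrite !ffunE evdl raddfB /= rmorphM /= map_mpolyX.
  by rewrite rmorph_nat -(map_mpolyX phi m) -rmorphM /= /secB map_lin_ext.
move=> hg; have -> : g = corr g.
  apply/ffunP => a; rewrite !ffunE /secB.
  have -> : ev g = 0.
    by rewrite -[RHS]hg; apply: eq_bigr => b _; rewrite ffunE.
  by rewrite lin_ext0 subr0.
have -> : g = \sum_a dl a (g a).
  apply/ffunP => b; rewrite sum_ffunE (bigD1 b) //= ffunE eqxx mul1r big1 ?addr0 //.
  by move=> a; rewrite ffunE eq_sym => /negbTE->; rewrite mul0r.
elim/big_ind: _ => // [|h k hh hk].
  suff -> : corr 0 = 0 by [].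
  apply/ffunP => b; rewrite !ffunE /secB (_ : ev 0 = 0) ?lin_ext0 ?subr0 //.
  by rewrite /ev big1 // => a _; rewrite ffunE mul0r.
by rewrite corrD; apply: ED.
Qed.

End ExtIdeal.

(** * The functors *)

Section Functoriality.
Variables (n : nat) (J : pred 'X_{1..n.+1}) (P : {fset 'X_{1..n.+1}}).

Lemma map_mpoly_id (A : comNzRingType) (p : {mpoly A[n.+1]}) :
  map_mpoly (@idfun A) p = p.
Proof. by apply/mpolyP => m; rewrite mcoeff_map_mpoly. Qed.

Lemma map_mpoly_compE (A B C : comNzRingType) (phi : {rmorphism A -> B})
    (psi : {rmorphism B -> C}) (p : {mpoly A[n.+1]}) :
  map_mpoly (psi \o phi) p = map_mpoly psi (map_mpoly phi p).
Proof. by apply/mpolyP => m; rewrite !mcoeff_map_mpoly. Qed.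

Lemma ext_ideal_id (A : comNzRingType) (M : {mpoly A[n.+1]} -> Prop) :
  is_ideal M -> ext_ideal (@idfun A) M = M.
Proof.
move=> Mi; apply/funext => p; apply/propext; split.
  apply: (@rspan_min {mpoly A[n.+1]} {mpoly A[n.+1]}^o _ M).
    exact/ideal_is_submodule.
  by move=> _ [q Mq ->]; rewrite map_mpoly_id.
by move=> Mp; rewrite -[p]map_mpoly_id; apply: (ext_ideal_mem idfun).
Qed.

Lemma ext_syz_id (A : comNzRingType) (S : {ffun P -> {mpoly A[n.+1]}^o} -> Prop) :
  is_submodule S -> ext_syz (@idfun A) S = S.
Proof.
move=> Sm; apply/funext => g; apply/propext.
have idE (h : {ffun P -> {mpoly A[n.+1]}^o}) : [ffun a => map_mpoly idfun (h a)] = h.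
  by apply/ffunP => a; rewrite ffunE map_mpoly_id.
split; last by move=> Sg; apply: rspan_gen; exists g.
by apply: (rspan_min (W := S)) => // _ [h Sh ->]; rewrite idE.
Qed.

Section Composition.
Variables (A B C : comNzRingType) (phi : {rmorphism A -> B}) (psi : {rmorphism B -> C}).

Lemma ext_ideal_comp (M : {mpoly A[n.+1]} -> Prop) :
  ext_ideal (psi \o phi) M = ext_ideal psi (ext_ideal phi M).
Proof.
apply/funext => p; apply/propext; split.
  apply: (@rspan_min {mpoly C[n.+1]} {mpoly C[n.+1]}^o _
    (ext_ideal psi (ext_ideal phi M))).
    exact: rspan_submodule.
  by move=> _ [q Mq ->]; rewrite map_mpoly_compE; do 2!apply: ext_ideal_mem.
have [E0 ED EM] : is_ideal (ext_ideal (psi \o phi) M) by exact: ideal_genP.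
apply: (@rspan_min {mpoly C[n.+1]} {mpoly C[n.+1]}^o _ (ext_ideal (psi \o phi) M)).
  exact: rspan_submodule.
move=> _ [q Mq ->]; move: q Mq.
apply: (@rspan_min {mpoly B[n.+1]} {mpoly B[n.+1]}^o _
  (fun q => ext_ideal (psi \o phi) M (map_mpoly psi q))).
  split=> [|q r hq hr|c q hq]; first by rewrite raddf0.
    by rewrite raddfD; apply: ED.
  by rewrite -[c *: q]/(c * q) (rmorphM (map_mpoly psi)); apply: EM.
by move=> _ [q Mq ->]; rewrite -map_mpoly_compE; apply: (ext_ideal_mem (psi \o phi)).
Qed.

Lemma ext_syz_comp (S : {ffun P -> {mpoly A[n.+1]}^o} -> Prop) :
  ext_syz (psi \o phi) S = ext_syz psi (ext_syz phi S).
Proof.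
apply/funext => g; apply/propext; split.
  apply: (rspan_min (W := ext_syz psi (ext_syz phi S))); first exact: rspan_submodule.
  move=> _ [h Sh ->]; apply: rspan_gen.
  exists [ffun a => map_mpoly phi (h a)]; first by apply: rspan_gen; exists h.
  by apply/ffunP => a; rewrite !ffunE map_mpoly_compE.
have [E0 ED EZ] : is_submodule (ext_syz (psi \o phi) S) := rspan_submodule _.
apply: (rspan_min (W := ext_syz (psi \o phi) S)); first exact: rspan_submodule.
move=> _ [h Sh ->]; move: h Sh.
apply: (rspan_min (W := fun h : {ffun P -> {mpoly B[n.+1]}^o} =>
  ext_syz (psi \o phi) S [ffun a => map_mpoly psi (h a)])).
  split=> [|q r hq hr|c q hq].
  - suff -> : [ffun a => map_mpoly psi
      ((0 : {ffun P -> {mpoly B[n.+1]}^o}) a)] = 0 by [].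
    by apply/ffunP => a; rewrite !ffunE raddf0.
  - suff -> : [ffun a => map_mpoly psi ((q + r) a)]
      = [ffun a => map_mpoly psi (q a)] + [ffun a => map_mpoly psi (r a)]
        :> {ffun P -> {mpoly C[n.+1]}^o} by apply: ED.
    by apply/ffunP => a; rewrite !ffunE raddfD.
  - suff -> : [ffun a => map_mpoly psi ((c *: q) a)]
      = map_mpoly psi c *: ([ffun a => map_mpoly psi (q a)]
        : {ffun P -> {mpoly C[n.+1]}^o}) by apply: EZ.
    by apply/ffunP => a; rewrite !ffunE; apply: (rmorphM (map_mpoly psi)).
move=> _ [h Sh ->]; apply: rspan_gen; exists h => //.
by apply/ffunP => a; rewrite !ffunE map_mpoly_compE.
Qed.

End Composition.

Lemma Mf_syz_ext (A B : comNzRingType) (phi : {rmorphism A -> B}) MS :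
  @Mf_syz_mem n J P A MS ->
  Mf_syz_mem J (ext_ideal phi MS.1, ext_syz phi MS.2).
Proof.
case: MS => M S [/= Mg Mc [F hF ->]]; have [Mi _] := Mg; split.
- exact: ext_graded.
- exact: ext_complement.
- exists [ffun a => map_mpoly phi (F a)]; first exact: ext_marked_basis.
  exact: (ext_syzE phi Mi hF).
Qed.

Lemma Mf_pi2E (A : comNzRingType) S :
  @Mf_pi2_mem n J P A S <-> exists M, Mf_syz_mem J (M, S).
Proof.
split=> [[M [F [Mg Mc hF ->]]]|[M [/= Mg Mc [F hF ->]]]]; exists M.
  by split=> //; exists F.
by exists F.
Qed.

Variable K : fieldType.

Lemma Mf_syz_functor : is_functor (Mf_syz J P K).
Proof.
split=> [A B phi MS|A [M S]|A B C phi psi [M S]] /=.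
- exact: Mf_syz_ext.
- case=> /= -[Mi _] _ [F _ ->].
  by rewrite ext_ideal_id // ext_syz_id //; apply: syz_submodule.
- by rewrite ext_ideal_comp ext_syz_comp.
Qed.

Lemma Mf_pi2_functor : is_functor (Mf_pi2 J P K).
Proof.
split=> [A B phi S|A S|A B C phi psi S] /=.
- move=> /Mf_pi2E[M /(Mf_syz_ext phi) hM]; apply/Mf_pi2E.
  by exists (ext_ideal phi M).
- by case=> M [F [_ _ _ ->]]; apply/ext_syz_id/syz_submodule.
- by rewrite ext_syz_comp.
Qed.

(** The inverse sends S1 to the union of all the ideals whose marked bases have
    syzygy module S1; by hypothesis there is just one, which also makes the inverse
    natural without further computation. *)
Lemma pi2_iso :
    (forall (A : noethAlg K) M M' S,
      Mf_syz_mem J (M, S) -> @Mf_syz_mem n J P A (M', S) -> M = M') ->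
  functor_iso (pi2_map J P K).
Proof.
move=> uniq; split.
  split=> [A [M S] hM|//]; apply/Mf_pi2E; by exists M.
pose rec (A : noethAlg K) (S : {ffun P -> {mpoly A[n.+1]}^o} -> Prop) :
  {mpoly A[n.+1]} -> Prop := fun p => exists2 M, Mf_syz_mem J (M, S) & M p.
have recE (A : noethAlg K) M S : @Mf_syz_mem n J P A (M, S) -> rec A S = M.
  move=> hM; apply/funext => p; apply/propext; split=> [[M' hM' M'p]|Mp].
    by rewrite (uniq _ _ _ _ hM hM').
  by exists M.
exists (fun A S => (rec A S, S)); split.
- split=> [A S /Mf_pi2E[M hM]|A B phi S /Mf_pi2E[M hM]] /=; rewrite (recE _ _ _ hM) //.
  by rewrite (recE _ _ _ (Mf_syz_ext phi hM)).
- by move=> A [M S] hM; rewrite /pi2_map /= (recE _ _ _ hM).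
- by [].
Qed.

End Functoriality.

Theorem theorem4p20 (K : fieldType) (n : nat) (J : ideal {mpoly K[n.+1]})
    (P : {fset 'X_{1..n.+1}}) (d : nat)
    (hJ : monomial_ideal J) (hP : is_pommaret_basis (terms J) P)
    (hd : is_depth J d) (hd2 : (2 <= d)%N) :
  [/\ forall c : Cidx (terms J) P,
        exists q : {mpoly K[#|{: Bidx P}|]},
          qproj (scrS (terms J) P K) (Cvar K c)
          = qproj (scrS (terms J) P K) (inclB (terms J) P K q),
      [/\ is_functor (Mf_syz (terms J) P K),
          is_functor (Mf_pi2 (terms J) P K)
        & functor_iso (pi2_map (terms J) P K)]
    & quotalg_iso (scrS (terms J) P K) (scrS_B (terms J) P K)].
Proof.
split; first exact: (parameter_elim hJ hP hd hd2); last first.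
  exact: (param_quot_iso hJ hP hd hd2).
split; [exact: Mf_syz_functor|exact: Mf_pi2_functor|apply: pi2_iso].
move=> A M M' S [/= _ _ [F hF eS]] [/= _ _ [F' hF' eS']].
(* The linear system of F is read off its syzygies, which are those of F'. *)
have [b hb] := marked_basis_syzygous hP hF.
have hb' : syzygous b F'.
  by apply/syzygous_syz; rewrite -eS' eS; apply/syzygous_syz.
have [mF MF _] := hF; have [mF' MF' _] := hF'.
have eF := depth2_uniq hJ hP hd hd2 mF mF' hb hb'; subst F'.
by apply/funext => p; apply/propext; split=> [/MF/MF'|/MF'/MF].
Qed.
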